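(* Every finite CAT(0) cube complex is collapsible.
   Context: A cube complex is a polyhedral complex obtained by gluing unit Euclidean cubes isometrically along faces; it is CAT(0) if, with the induced length metric, it is a CAT(0) metric space (in particular nonempty). A finite complex is collapsible if it can be reduced to a single vertex by a finite sequence of elementary collapses, where an elementary collapse removes a pair of cells $\sigma\subset\tau$ with $\dim\tau=\dim\sigma+1$ such that $\tau$ is the only cell properly containing $\sigma$. *)

(* Defs.v *)
From HB Require Import structures.
From mathcomp Require Import all_boot all_order all_algebra.
From mathcomp Require Import all_classical all_reals all_analysis.

Set Implicit Arguments.
Unset Strict Implicit.
Unset Printing Implicit Defensive.
Import Order.TTheory GRing.Theory Num.Theory.

Local Open Scope classical_set_scope.
Local Open Scope ring_scope.

(* The library's norm on row vectors is the sup norm, hence this definition. *)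
Definition eucl_dist (R : realType) (n : nat) (u v : 'rV[R]_n) : R :=
  Num.sqrt (\sum_(i < n) (u ord0 i - v ord0 i) ^+ 2).

Definition segment (R : realType) (n : nat) (u v : 'rV[R]_n) : set 'rV[R]_n :=
  [set w | exists2 t : R, 0 <= t <= 1 & w = (1 - t) *: u + t *: v].

Definition unit_cube (R : realType) (n : nat) : set 'rV[R]_n :=
  [set u | forall i, 0 <= u ord0 i <= 1].
Arguments unit_cube : clear implicits.

(* The nonempty faces of [0,1]^n: the i-th coordinate is free if a i = None and
   frozen to 0 (resp. 1) if a i = Some false (resp. Some true). *)
Definition cube_face (R : realType) (n : nat) (a : 'I_n -> option bool) :
    set 'rV[R]_n :=
  unit_cube R n `&`
  [set u | forall i b, a i = Some b -> u ord0 i = (b : nat)%:R].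
Arguments cube_face R {n} a.

(* A finite cube complex: the space complex_point is the union of the images of
   finitely many unit cubes, one for each cell, under the characteristic maps
   chart c (only their restrictions to the unit cubes are relevant).
   As usual for polyhedral complexes, the family of cells is closed under
   passing to faces and any two cells that meet do so in a common face; that
   face is identified through an isometry between a face of one cube and a face
   of the other. *)
Record fin_cube_complex (R : realType) := FinCubeComplex {
  cell : finType;
  cell_dim : cell -> nat;
  complex_point : Type;
  chart : forall c : cell, 'rV[R]_(cell_dim c) -> complex_point;
  chart_inj : forall (c : cell) (u v : 'rV[R]_(cell_dim c)),
    unit_cube R (cell_dim c) u -> unit_cube R (cell_dim c) v ->
    chart u = chart v -> u = v;
  chart_cover : forall x : complex_point,
    exists c : cell, (@chart c @` unit_cube R (cell_dim c)) x;
  cell_inj : forall c c' : cell,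
    @chart c @` unit_cube R (cell_dim c) =
    @chart c' @` unit_cube R (cell_dim c') -> c = c';
  face_cell : forall (c : cell) (a : 'I_(cell_dim c) -> option bool),
    exists c' : cell,
      @chart c' @` unit_cube R (cell_dim c') = @chart c @` cube_face R a;
  cell_glue : forall c c' : cell,
    (@chart c @` unit_cube R (cell_dim c)) `&`
    (@chart c' @` unit_cube R (cell_dim c')) !=set0 ->
    exists (a : 'I_(cell_dim c) -> option bool)
           (a' : 'I_(cell_dim c') -> option bool)
           (h : 'rV[R]_(cell_dim c) -> 'rV[R]_(cell_dim c')),
      [/\ h @` cube_face R a = cube_face R a',
          (forall u v, cube_face R a u -> cube_face R a v ->
             eucl_dist (h u) (h v) = eucl_dist u v) &
          (forall u v, unit_cube R (cell_dim c) u ->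
             unit_cube R (cell_dim c') v ->
             (chart u = chart v <-> cube_face R a u /\ v = h u))]
}.

Arguments chart {R f c}.

Definition carrier (R : realType) (K : fin_cube_complex R) (c : cell K) :
    set (complex_point K) :=
  @chart R K c @` unit_cube R (cell_dim c).

(* chain_of_length x y l: some broken line from x to y, made of finitely many
   straight segments each contained in a cell, has length l. *)
Inductive chain_of_length (R : realType) (K : fin_cube_complex R) :
    complex_point K -> complex_point K -> R -> Prop :=
| chain_nil x : chain_of_length x x 0
| chain_step (c : cell K) (u v : 'rV[R]_(cell_dim c)) y l :
    unit_cube R (cell_dim c) u -> unit_cube R (cell_dim c) v ->
    chain_of_length (chart v) y l ->
    chain_of_length (chart u) y (eucl_dist u v + l).

(* Equal to +oo when x and y lie in different connected components. *)
Definition length_dist (R : realType) (K : fin_cube_complex R)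
    (x y : complex_point K) : \bar R :=
  ereal_inf [set l%:E | l in chain_of_length x y].

Definition geodesic_segment (R : realType) (T : metricType R) (x y : T)
    (S : set T) : Prop :=
  exists (l : R) (g : R -> T),
    [/\ 0 <= l, g 0 = x, g l = y,
        (forall s t, 0 <= s <= l -> 0 <= t <= l ->
           mdist (g s) (g t) = `|s - t|) &
        S = g @` [set t | 0 <= t <= l]].

(* The triangle has vertices v 0, v 1, v 2 and sides S i from v i to v (i + 1),
   where ordS is the cyclic successor; w is the comparison triangle, and p', q'
   are the comparison points of p, q. *)
Definition CAT0_inequality (R : realType) (T : metricType R) : Prop :=
  forall (v : 'I_3 -> T) (S : 'I_3 -> set T) (w : 'I_3 -> 'rV[R]_2),
    (forall i, geodesic_segment (v i) (v (ordS i)) (S i)) ->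
    (forall i j, eucl_dist (w i) (w j) = mdist (v i) (v j)) ->
    forall (i j : 'I_3) (p q : T) (p' q' : 'rV[R]_2),
      S i p -> segment (w i) (w (ordS i)) p' ->
      eucl_dist (w i) p' = mdist (v i) p ->
      S j q -> segment (w j) (w (ordS j)) q' ->
      eucl_dist (w j) q' = mdist (v j) q ->
      mdist p q <= eucl_dist p' q'.

Definition CAT0_space (R : realType) (T : metricType R) : Prop :=
  [/\ [set: T] !=set0,
      (forall x y : T, exists S : set T, geodesic_segment x y S) &
      CAT0_inequality T].

Definition CAT0_complex (R : realType) (K : fin_cube_complex R) : Prop :=
  exists (T : metricType R) (f : complex_point K -> T),
    [/\ bijective f,
        (forall x y, (mdist (f x) (f y))%:E = length_dist x y) &
        CAT0_space T].

(* Subcomplexes are represented by their sets of cells. *)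
Definition elementary_collapse (R : realType) (K : fin_cube_complex R)
    (A B : {set cell K}) : Prop :=
  exists s t : cell K,
    [/\ s \in A /\ t \in A,
        carrier s `<` carrier t,
        cell_dim t = (cell_dim s).+1,
        (forall c, c \in A -> carrier s `<` carrier c -> c = t) &
        B = A :\: [set s; t]%SET].

Definition collapsible (R : realType) (K : fin_cube_complex R) : Prop :=
  exists2 c : cell K, cell_dim c = 0%N &
    connect (fun A B : {set cell K} => `[< elementary_collapse A B >])
      [set: cell K]%SET [set c]%SET.

(* Main.v *)
(* Fix a vertex x. Cells of a CAT(0) cube complex are convex: a straight segment of
   a cell is a local geodesic, because the star of a point retracts onto each of
   its cells without increasing lengths. Along an edge direction of a cell the
   distance to x has no minimum at an interior point: a geodesic to x issuing from
   such a point would remain perpendicular to that direction and keep a fractional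
   coordinate, whereas x is a vertex. Hence in every cell the distance to x is
   monotone in each coordinate, with a direction depending on the coordinate only,
   and every cell has a unique vertex farthest from x, its top. If v <> x, let Q be
   the smallest cell containing an initial segment of the geodesic from v to x. An
   edge issuing from v outside Q makes an angle at least pi / 2 with this geodesic,
   so that the distance to x grows along it; therefore the cells with top v are
   exactly the faces of Q through v. Match these faces along one coordinate of Q,
   and collapse the matched pairs by decreasing distance from x to their top and,
   for a given top, by decreasing dimension. *)
Require Import Defs.
From mathcomp Require Import all_boot all_order all_algebra.
From mathcomp Require Import all_classical all_reals all_analysis.
From mathcomp Require Import ring lra.

Set Implicit Arguments.
Unset Strict Implicit.
Unset Printing Implicit Defensive.
Import Order.TTheory GRing.Theory Num.Theory numFieldNormedType.Exports.

Local Open Scope classical_set_scope.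
Local Open Scope ring_scope.

(** * Euclidean distance *)

Section Euclidean.
Variables (R : realType) (n : nat).
Implicit Types (u v w : 'rV[R]_n) (i : 'I_n) (s t : R).

Lemma eucl_dist_sqr u v :
  eucl_dist u v ^+ 2 = \sum_(i < n) (u ord0 i - v ord0 i) ^+ 2.
Proof. by rewrite sqr_sqrtr// sumr_ge0// => i _; rewrite sqr_ge0. Qed.

Lemma eucl_dist_ge0 u v : 0 <= eucl_dist u v.
Proof. exact: sqrtr_ge0. Qed.

Lemma eucl_distC u v : eucl_dist u v = eucl_dist v u.
Proof.
by congr Num.sqrt; apply: eq_bigr => i _; rewrite -sqrrN opprB.
Qed.

Lemma eucl_distxx u : eucl_dist u u = 0.
Proof. by rewrite /eucl_dist big1 ?sqrtr0// => i _; rewrite subrr expr0n. Qed.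

Lemma coord_le_eucl_dist u v i : `|u ord0 i - v ord0 i| <= eucl_dist u v.
Proof.
rewrite -sqrtr_sqr ler_wsqrtr// (bigD1 i)//= lerDl sumr_ge0// => j _.
exact: sqr_ge0.
Qed.

Lemma eucl_dist_eq0 u v : eucl_dist u v = 0 -> u = v.
Proof.
move=> uv; apply/rowP => i; have := coord_le_eucl_dist u v i.
by rewrite uv normr_le0 subr_eq0 => /eqP.
Qed.

Lemma eucl_dist_triangle u v w :
  eucl_dist u w <= eucl_dist u v + eucl_dist v w.
Proof.
have [vw0|vw0] := eqVneq (eucl_dist v w) 0.
  by rewrite (eucl_dist_eq0 vw0) eucl_distxx addr0.
have vw_gt0 : 0 < eucl_dist v w by rewrite lt_neqAle eq_sym vw0 eucl_dist_ge0.
set A := eucl_dist u v; set B := eucl_dist v w.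
have A0 : 0 <= A by exact: eucl_dist_ge0.
rewrite -(@ler_pXn2r _ 2)// ?nnegrE ?addr_ge0 ?eucl_dist_ge0//.
pose P := \sum_(i < n) (u ord0 i - v ord0 i) * (v ord0 i - w ord0 i).
have expand t : \sum_(i < n) ((u ord0 i - v ord0 i) + t * (v ord0 i - w ord0 i)) ^+ 2
   = A ^+ 2 + 2 * t * P + t ^+ 2 * B ^+ 2.
  rewrite /A /B !eucl_dist_sqr /P !mulr_sumr -!big_split/=.
  by apply: eq_bigr => i _; ring.
have uwE : eucl_dist u w ^+ 2 = A ^+ 2 + 2 * P + B ^+ 2.
  have := expand 1; rewrite mulr1 expr1n mul1r => <-.
  by rewrite eucl_dist_sqr; apply: eq_bigr => i _; ring.
(* After squaring, what remains is Cauchy-Schwarz. At [t = - (A / B)] the sum of squares in [expand]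
   equals a nonnegative multiple of [A * B - P]. *)
suff : P <= A * B by rewrite uwE; move: (A) (B) => a b; nra.
have [A00|Ap] := eqVneq A 0.
  rewrite A00 mul0r /P big1// => i _.
  by rewrite (eucl_dist_eq0 A00) subrr mul0r.
have Agt0 : 0 < A by rewrite lt_neqAle eq_sym Ap.
have := expand (- (A / B)).
have -> : A ^+ 2 + 2 * (- (A / B)) * P + (- (A / B)) ^+ 2 * B ^+ 2 =
  2 * (A / B) * (A * B - P) by field.
move=> E; have : 0 <= 2 * (A / B) * (A * B - P).
  by rewrite -E sumr_ge0// => i _; rewrite sqr_ge0.
by rewrite pmulr_rge0 ?subr_ge0// mulr_gt0// divr_gt0.
Qed.

Lemma eucl_dist_along u v s t :
  eucl_dist (u + s *: (v - u)) (u + t *: (v - u)) = `|s - t| * eucl_dist u v.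
Proof.
rewrite -[`|s - t|]sqrtr_sqr -sqrtrM ?sqr_ge0//; congr Num.sqrt.
rewrite mulr_sumr; apply: eq_bigr => i _; rewrite !mxE; ring.
Qed.

Definition upd u i t : 'rV[R]_n := \row_k (if k == i then t else u ord0 k).

Lemma updE u i t : (upd u i t) ord0 i = t.
Proof. by rewrite mxE eqxx. Qed.

Lemma upd_id u i : upd u i (u ord0 i) = u.
Proof. by apply/rowP => k; rewrite mxE; case: eqP => [->|]. Qed.

Lemma upd_upd u i s t : upd (upd u i s) i t = upd u i t.
Proof. by apply/rowP => k; rewrite !mxE; case: eqP. Qed.

Lemma eucl_dist_upd u i s t : eucl_dist (upd u i s) (upd u i t) = `|s - t|.
Proof.
rewrite -sqrtr_sqr; congr Num.sqrt; rewrite (bigD1 i)//= !updE big1 ?addr0//.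
by move=> k /negPf ki; rewrite !mxE ki subrr expr0n.
Qed.

Lemma eucl_dist_updl u i t : eucl_dist (upd u i t) u = `|t - u ord0 i|.
Proof. by rewrite -(eucl_dist_upd u i) upd_id. Qed.

Lemma eucl_dist_upd_sqr u v i :
  eucl_dist u v ^+ 2 =
  (u ord0 i - v ord0 i) ^+ 2 + eucl_dist u (upd v i (u ord0 i)) ^+ 2.
Proof.
rewrite !eucl_dist_sqr [LHS](bigD1 i)//= [in RHS](bigD1 i)//= updE subrr expr0n.
rewrite add0r; congr (_ + _); apply: eq_bigr => k /negPf ki.
by rewrite !mxE ki.
Qed.

Lemma eucl_dist_upd_le u v i t : eucl_dist (upd u i t) (upd v i t) <= eucl_dist u v.
Proof.
apply: ler_wsqrtr; apply: ler_sum => k _; rewrite !mxE; case: eqP => // _.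
by rewrite subrr expr0n sqr_ge0.
Qed.

Lemma upd_cube u i t : unit_cube R n u -> 0 <= t <= 1 -> unit_cube R n (upd u i t).
Proof. by move=> cu ct k; rewrite mxE; case: eqP. Qed.

Lemma cube_convex u v t : unit_cube R n u -> unit_cube R n v -> 0 <= t <= 1 ->
  unit_cube R n (u + t *: (v - u)).
Proof.
move=> cu cv /andP[t0 t1] k; rewrite !mxE.
have /andP[? ?] := cu k; have /andP[? ?] := cv k.
by apply/andP; split; nra.
Qed.

End Euclidean.

(** * Isometries between faces *)

Section Faces.
Variable R : realType.

(** The two isometries of the unit interval: an isometry between faces acts on each free coordinate
    by one of them. *)
Definition flip (b : bool) (t : R) : R := if b then 1 - t else t.

Lemma flip01 b t : 0 <= t <= 1 -> 0 <= flip b t <= 1.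
Proof. by case: b => //= /andP[? ?]; apply/andP; split; lra. Qed.

Lemma flipK b : involutive (flip b).
Proof. by case: b => //= t; rewrite /flip opprB addrC subrK. Qed.

Definition face_corner n (a : 'I_n -> option bool) : 'rV[R]_n :=
  \row_k (if a k is Some b then (b : nat)%:R else 0).

Lemma bool01 (b : bool) : 0 <= ((b : nat)%:R : R) <= 1.
Proof. by case: b; rewrite ?lexx ler01. Qed.

Lemma face_cornerP n (a : 'I_n -> option bool) : cube_face R a (face_corner a).
Proof.
split=> [k|k b]; rewrite mxE; last by move=> ->.
by case: (a k) => [b|]; rewrite ?bool01// lexx ler01.
Qed.

Lemma cube_face_upd n (a : 'I_n -> option bool) u i t :
  cube_face R a u -> a i = None -> 0 <= t <= 1 -> cube_face R a (upd u i t).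
Proof.
move=> [cu fu] ai t01; split; first exact: upd_cube.
by move=> k b ak; rewrite mxE; case: eqP => [ki|_]; [rewrite ki ai in ak|exact: fu].
Qed.

Lemma cube_face_free n (a : 'I_n -> option bool) u i :
  cube_face R a u -> 0 < u ord0 i < 1 -> a i = None.
Proof.
move=> [_ fu]; case ai : (a i) => [b|]//; rewrite (fu _ _ ai).
by case: b {ai}; rewrite ltxx ?andbF.
Qed.

Definition binary n (u : 'rV[R]_n) := forall i, u ord0 i = 0 \/ u ord0 i = 1.

Lemma face_corner_binary n (a : 'I_n -> option bool) : binary (face_corner a).
Proof. by move=> k; rewrite mxE; case: (a k) => [[]|]; [right|left|left]. Qed.

Section FaceIsometry.
Variables (m n : nat) (a : 'I_m -> option bool) (a' : 'I_n -> option bool).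
Variable h : 'rV[R]_m -> 'rV[R]_n.
Hypothesis h_face : forall u, cube_face R a u -> cube_face R a' (h u).
Hypothesis h_onto :
  forall v, cube_face R a' v -> exists2 u, cube_face R a u & h u = v.
Hypothesis h_iso : forall u v, cube_face R a u -> cube_face R a v ->
  eucl_dist (h u) (h v) = eucl_dist u v.

(* The corners are the points that are not midpoints of nondegenerate segments,
   and being a midpoint is expressible by distances. *)
Lemma isometry_binary z : cube_face R a z -> binary z -> binary (h z).
Proof.
move=> fz bz k; apply: contrapT => /not_orP[/eqP hk0 /eqP hk1].
have fy := h_face fz; set y := h z in fy hk0 hk1 *.
have /andP[y0 y1] := fy.1 k.
have yk : 0 < y ord0 k < 1 by rewrite !lt_neqAle hk1 y0 y1 eq_sym hk0.
have ak := cube_face_free fy yk.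
pose d := Num.min (y ord0 k) (1 - y ord0 k).
have d0 : 0 < d by rewrite lt_min subr_gt0.
have /andP[dy dy1] : (d <= y ord0 k) && (d <= 1 - y ord0 k).
  by rewrite !ge_min !lexx ?orbT.
have [z1 fz1 hz1] : exists2 u, cube_face R a u & h u = upd y k (y ord0 k + d).
  by apply/h_onto/cube_face_upd => //; apply/andP; split; lra.
have [z2 fz2 hz2] : exists2 u, cube_face R a u & h u = upd y k (y ord0 k - d).
  by apply/h_onto/cube_face_upd => //; apply/andP; split; lra.
have E1 : eucl_dist z1 z = d.
  rewrite -h_iso// hz1 -/y eucl_dist_updl.
  by rewrite addrAC subrr add0r gtr0_norm.
have E2 : eucl_dist z2 z = d.
  rewrite -h_iso// hz2 -/y eucl_dist_updl.
  by rewrite addrAC subrr add0r normrN gtr0_norm.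
have E3 : eucl_dist z1 z2 = 2 * d.
  rewrite -h_iso// hz1 hz2 eucl_dist_upd.
  have -> : y ord0 k + d - (y ord0 k - d) = 2 * d by ring.
  by rewrite gtr0_norm// mulr_gt0.
(* By the parallelogram identity [z] is the midpoint of [z1] and [z2]. Its coordinates are extreme
   in the unit interval, so [z1 = z], against [0 < d]. *)
have S0 : \sum_(i < m) (z1 ord0 i + z2 ord0 i - 2 * z ord0 i) ^+ 2 = 0.
  have -> : \sum_(i < m) (z1 ord0 i + z2 ord0 i - 2 * z ord0 i) ^+ 2 =
    2 * eucl_dist z1 z ^+ 2 + 2 * eucl_dist z2 z ^+ 2 - eucl_dist z1 z2 ^+ 2.
    rewrite !eucl_dist_sqr !mulr_sumr -big_split/= -sumrB.
    by apply: eq_bigr => i _; ring.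
  by rewrite E1 E2 E3; ring.
have zz1 : z1 = z.
  apply/rowP => i.
  have /psumr_eq0P : forall i, true -> 0 <= (z1 ord0 i + z2 ord0 i - 2 * z ord0 i) ^+ 2.
    by move=> *; exact: sqr_ge0.
  move=> /(_ S0 i isT)/eqP; rewrite sqrf_eq0 subr_eq0 => /eqP.
  have /andP[? ?] := fz1.1 i; have /andP[? ?] := fz2.1 i.
  by case: (bz i) => ->; lra.
by move: d0; rewrite -E1 zz1 eucl_distxx ltxx.
Qed.

(** The corner [z] and its neighbour [z1] along axis [i] go to corners at distance 1, which
    therefore differ in a single coordinate [j]. The difference of the squared distances to the two
    ends of an edge is affine in the coordinate along it, which recovers this coordinate from
    distances. *)
Lemma isometry_coord i : a i = None -> exists j b, a' j = None /\
  forall u, cube_face R a u -> (h u) ord0 j = flip b (u ord0 i).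
Proof.
move=> ai; set z := face_corner a.
have fz : cube_face R a z by exact: face_cornerP.
have bz : binary z by exact: face_corner_binary.
have zi : z ord0 i = 0 by rewrite mxE ai.
pose z1 := upd z i 1.
have fz1 : cube_face R a z1 by apply: cube_face_upd => //; rewrite ler01 lexx.
have bz1 : binary z1 by move=> k; rewrite mxE; case: eqP => // _; right.
have bh := isometry_binary fz bz; have bh1 := isometry_binary fz1 bz1.
have dz : eucl_dist (h z) (h z1) = 1.
  by rewrite h_iso// eucl_distC eucl_dist_updl zi subr0 normr1.
have [j jP] : exists j, (h z) ord0 j != (h z1) ord0 j.
  apply: contrapT => /forallNP E; move: dz.
  suff -> : h z = h z1 by rewrite eucl_distxx => /eqP; rewrite eq_sym oner_eq0.
  by apply/rowP => k; apply/eqP/negPn/negP/E.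
have hj : (h z) ord0 j = 0 /\ (h z1) ord0 j = 1 \/
          (h z) ord0 j = 1 /\ (h z1) ord0 j = 0.
  by case: (bh j) (bh1 j) jP => [->|->] [->|->]; rewrite ?eqxx//; [left|right].
have others k : k != j -> (h z) ord0 k = (h z1) ord0 k.
  move=> kj; have := congr1 (fun x => x ^+ 2) dz.
  rewrite /= eucl_dist_sqr (bigD1 j)//=.
  have -> : ((h z) ord0 j - (h z1) ord0 j) ^+ 2 = 1.
    by case: hj => [[-> ->]|[-> ->]]; ring.
  rewrite expr1n => /eqP; rewrite -subr_eq0 addrAC subrr add0r => /eqP.
  move/psumr_eq0P => /(_ (fun i _ => sqr_ge0 _) k kj)/eqP.
  by rewrite sqrf_eq0 subr_eq0 => /eqP.
exists j, ((h z) ord0 j == 1); split.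
  case aj : (a' j) => [b|]//; move/eqP: jP.
  by rewrite ((h_face fz).2 _ _ aj) ((h_face fz1).2 _ _ aj).
move=> u fu; set y := h u.
have : eucl_dist y (h z) ^+ 2 - eucl_dist y (h z1) ^+ 2 =
       eucl_dist u z ^+ 2 - eucl_dist u z1 ^+ 2 by rewrite /y !h_iso.
rewrite !eucl_dist_sqr (bigD1 j)//= [X in _ - X = _](bigD1 j)//=.
rewrite (eq_bigr (fun k => (y ord0 k - (h z1) ord0 k) ^+ 2)); last first.
  by move=> k kj; rewrite others.
rewrite [X in _ = X - _](bigD1 i)//= [X in _ = _ - X](bigD1 i)//= zi updE.
rewrite [in RHS](eq_bigr (fun k => (u ord0 k - z1 ord0 k) ^+ 2)); last first.
  by move=> k /negPf ki; rewrite !mxE ki.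
set S := \sum_(_ < _ | _) _; set S' := \sum_(_ < _ | _) _.
have -> (p q : R) : p ^+ 2 + S - (q ^+ 2 + S) = p ^+ 2 - q ^+ 2 by ring.
have -> (p q : R) : p ^+ 2 + S' - (q ^+ 2 + S') = p ^+ 2 - q ^+ 2 by ring.
by case: hj => [[-> ->]|[-> ->]]; rewrite ?eqxx ?(eq_sym 0) ?oner_eq0 /flip => E; lra.
Qed.

(** Along axis [i] the [j]-th coordinate of the image already changes by the whole distance
    travelled, so Pythagoras leaves nothing for the other coordinates. *)
Lemma isometry_upd i u : a i = None -> cube_face R a u ->
  exists j b, (h u) ord0 j = flip b (u ord0 i) /\
    forall t, 0 <= t <= 1 -> h (upd u i t) = upd (h u) j (flip b t).
Proof.
move=> ai fu; have [j [b [aj hj]]] := isometry_coord ai; exists j, b.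
split=> [|t t01]; first exact: hj.
have fut := cube_face_upd fu ai t01.
apply: eucl_dist_eq0; have := eucl_dist_upd_sqr (h (upd u i t)) (h u) j.
rewrite h_iso// !hj// updE eucl_dist_updl.
have -> : (flip b t - flip b (u ord0 i)) ^+ 2 = (t - u ord0 i) ^+ 2.
  by case: (b); rewrite /flip; ring.
rewrite real_normK ?num_real// => /eqP.
by rewrite -subr_eq0 opprD addrA subrr sub0r oppr_eq0 sqrf_eq0 => /eqP.
Qed.

End FaceIsometry.

Definition face_free n (a : 'I_n -> option bool) := #|[pred i | a i == None]|.

Lemma face_diam_le n (a : 'I_n -> option bool) u v :
  cube_face R a u -> cube_face R a v -> eucl_dist u v ^+ 2 <= (face_free a)%:R.
Proof.
move=> [cu fu] [cv fv]; rewrite eucl_dist_sqr (bigID [pred i | a i == None])/=.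
rewrite [X in _ + X]big1 ?addr0; last first.
  move=> i; case ai : (a i) => [b|]// _.
  by rewrite (fu _ _ ai) (fv _ _ ai) subrr expr0n.
apply: (@le_trans _ _ (\sum_(i | a i == None) (1 : R))); last first.
  by rewrite sumr_const.
apply: ler_sum => i _; have /andP[? ?] := cu i; have /andP[? ?] := cv i.
nra.
Qed.

Lemma face_diam n (a : 'I_n -> option bool) : exists u v,
  [/\ cube_face R a u, cube_face R a v & eucl_dist u v ^+ 2 = (face_free a)%:R].
Proof.
pose v : 'rV[R]_n := \row_k (if a k is Some b then (b : nat)%:R else 1).
exists (face_corner a), v; split; first exact: face_cornerP.
  split=> [k|k b]; rewrite mxE; last by move=> ->.
  by case: (a k) => [b|]; rewrite ?bool01// lexx ler01.
rewrite eucl_dist_sqr (bigID [pred i | a i == None])/=.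
rewrite [X in _ + X]big1 ?addr0; last first.
  by move=> i; rewrite !mxE; case: (a i) => // b _; rewrite subrr expr0n.
rewrite (eq_bigr (fun=> 1)) ?sumr_const// => i /eqP ai.
by rewrite !mxE ai; ring.
Qed.

(** The squared diameter of a face is its number of free coordinates, and isometries preserve
    diameters. *)
Lemma isometry_face_free m n (a : 'I_m -> option bool) (a' : 'I_n -> option bool)
    (h : 'rV[R]_m -> 'rV[R]_n) :
  (forall u, cube_face R a u -> cube_face R a' (h u)) ->
  (forall v, cube_face R a' v -> exists2 u, cube_face R a u & h u = v) ->
  (forall u v, cube_face R a u -> cube_face R a v ->
     eucl_dist (h u) (h v) = eucl_dist u v) ->
  face_free a = face_free a'.
Proof.
move=> hf ho hi; apply/eqP; rewrite eqn_leq -!(ler_nat R); apply/andP; split.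
  have [u [v [fu fv <-]]] := face_diam a.
  by rewrite -hi//; apply: face_diam_le; exact: hf.
have [u [v [fu fv <-]]] := face_diam a'.
have [u1 fu1 <-] := ho _ fu; have [v1 fv1 <-] := ho _ fv.
by rewrite hi//; exact: face_diam_le.
Qed.

End Faces.

(** * Cells and their common faces *)

Section Gluing.
Variables (R : realType) (K : fin_cube_complex R).
Implicit Types (c s : cell K) (y : complex_point K).

Definition whole c : 'I_(cell_dim c) -> option bool := fun=> None.

Lemma whole_face c : cube_face R (@whole c) = unit_cube R (cell_dim c).
Proof. by apply/seteqP; split => [u []//|u cu]; split. Qed.

Lemma carrier_chart c u : unit_cube R (cell_dim c) u -> carrier c (chart u).
Proof. by exists u. Qed.

Lemma common_face c c' y : carrier c y -> carrier c' y ->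
  exists a : 'I_(cell_dim c) -> option bool, forall u,
    unit_cube R (cell_dim c) u -> carrier c' (chart u) <-> cube_face R a u.
Proof.
move=> cy c'y; have [|a [a' [h [ha _ hg]]]] := @cell_glue _ K c c'; first by exists y.
exists a => u cu; split=> [[v cv uv]|fu].
  by have [/(_ (esym uv))[]] := hg u v cu cv.
have fhu : cube_face R a' (h u) by rewrite -ha; exists u.
exists (h u); first exact: fhu.1.
by apply/esym/hg => //; exact: fhu.1.
Qed.

Lemma glue_dist c c' (u1 u2 : 'rV[R]_(cell_dim c)) (v1 v2 : 'rV[R]_(cell_dim c')) :
  unit_cube R _ u1 -> unit_cube R _ u2 -> unit_cube R _ v1 -> unit_cube R _ v2 ->
  chart u1 = chart v1 -> chart u2 = chart v2 -> eucl_dist u1 u2 = eucl_dist v1 v2.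
Proof.
move=> cu1 cu2 cv1 cv2 e1 e2.
have [|a [a' [h [ha hi hg]]]] := @cell_glue _ K c c'.
  by exists (chart u1); split; [exact: carrier_chart|rewrite e1; exact: carrier_chart].
have [/(_ e1)[f1 ->] _] := hg _ _ cu1 cv1.
by have [/(_ e2)[f2 ->] _] := hg _ _ cu2 cv2; rewrite hi.
Qed.

(** A fractional coordinate is not frozen in the common face of the two cells, so this face contains
    the whole coordinate line and the gluing isometry applies to it. *)
Lemma glue_line c c' (u : 'rV[R]_(cell_dim c)) (v : 'rV[R]_(cell_dim c')) i :
  unit_cube R _ u -> unit_cube R _ v -> chart u = chart v -> 0 < u ord0 i < 1 ->
  exists j b, v ord0 j = flip b (u ord0 i) /\
    forall t, 0 <= t <= 1 -> chart (upd u i t) = chart (upd v j (flip b t)).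
Proof.
move=> cu cv uv ui; have [|a [a' [h [ha hi hg]]]] := @cell_glue _ K c c'.
  by exists (chart u); split; [exact: carrier_chart|rewrite uv; exact: carrier_chart].
have [/(_ uv)[fu vE] _] := hg _ _ cu cv.
have ai := cube_face_free fu ui.
have hf u' : cube_face R a u' -> cube_face R a' (h u') by rewrite -ha; exists u'.
have ho v' : cube_face R a' v' -> exists2 u', cube_face R a u' & h u' = v'.
  by rewrite -ha => -[u' fu' <-]; exists u'.
have [j [b [hj hl]]] := isometry_upd hf ho hi ai fu.
exists j, b; rewrite vE; split => // t t01.
have fut := cube_face_upd fu ai t01; apply/hg; first exact: fut.1.
  by rewrite -hl//; exact: (hf _ fut).1.
by split=> //; rewrite hl.
Qed.

Lemma cell_dim_face c c' (a : 'I_(cell_dim c) -> option bool) :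
  carrier c' = chart @` cube_face R a -> cell_dim c' = face_free a.
Proof.
move=> c'E.
have [|b [b' [h [hb hi hg]]]] := @cell_glue _ K c' c.
  exists (chart (face_corner R a)); have fa := face_cornerP R a; split.
    by rewrite -/(carrier c') c'E; exists (face_corner R a).
  exact/carrier_chart/fa.1.
have full u : unit_cube R _ u -> cube_face R b u /\ cube_face R a (h u).
  move=> cu; have : carrier c' (chart u) by exact: carrier_chart.
  rewrite c'E => -[v fv /esym uv].
  by have [/(_ uv)[fu <-] _] := hg _ _ cu fv.1.
have <- : face_free (@whole c') = cell_dim c'.
  by rewrite /face_free /whole cardT/= size_enum_ord.
apply: (@isometry_face_free R _ _ _ _ h); rewrite whole_face.
- by move=> u /full[].
- move=> v fv; have [u cu uv] : carrier c' (chart v) by rewrite c'E; exists v.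
  by exists u => //; have [/(_ uv)[_ ->]] := hg _ _ cu fv.1.
- by move=> u v /full[fu _] /full[fv _]; exact: hi.
Qed.

Lemma subcell_face c s : carrier s `<=` carrier c ->
  exists a : 'I_(cell_dim c) -> option bool, carrier s = chart @` cube_face R a.
Proof.
move=> sc.
have sy : carrier s (chart (face_corner R (@whole s))).
  exact/carrier_chart/(face_cornerP R _).1.
have [a aP] := common_face (sc _ sy) sy; exists a.
apply/seteqP; split=> [y cy|y [u fu <-]]; last by apply/aP => //; exact: fu.1.
by have [u cu uy] := sc _ cy; exists u => //; apply/aP => //; rewrite uy.
Qed.

Lemma chart_face_mem c (a : 'I_(cell_dim c) -> option bool) u :
  unit_cube R _ u -> (chart @` cube_face R a) (chart u) -> cube_face R a u.
Proof. by move=> cu [v fv /(chart_inj fv.1 cu) <-]. Qed.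

End Gluing.

(** * The Bruhat-Tits inequality *)

Section CAT0.
Variables (R : realType) (T : metricType R).
Implicit Types a b c m : T.

(** A shortcut from a point of the first piece to one of the second would give a path from [b] to
    [c] shorter than [mdist b c]. The lemma serves to place [m] on a side of a geodesic triangle. *)
Lemma concat_geodesic b c m S1 S2 :
  geodesic_segment b m S1 -> geodesic_segment m c S2 ->
  mdist b m + mdist m c = mdist b c ->
  exists2 S, geodesic_segment b c S & S m.
Proof.
move=> [l1 [g1 [l10 g10 g1l g1d _]]] [l2 [g2 [l20 g20 g2l g2d _]]] bmc.
have bm : mdist b m = l1.
  by rewrite -g10 -g1l g1d ?lexx ?l10// sub0r normrN ger0_norm.
have mc : mdist m c = l2.
  by rewrite -g20 -g2l g2d ?lexx ?l20// sub0r normrN ger0_norm.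
pose g t := if t <= l1 then g1 t else g2 (t - l1).
pose S := g @` [set t | 0 <= t <= l1 + l2].
have gl : g (l1 + l2) = c.
  rewrite /g; case: ifPn => [|_]; last by rewrite addrAC subrr add0r.
  rewrite gerDl => l20'; have l200 : l2 = 0 by apply/eqP; rewrite eq_le l20' l20.
  by rewrite l200 addr0 g1l -g20 -g2l l200.
exists S; last by exists l1; rewrite /= ?/g ?lexx// l10 lerDl.
exists (l1 + l2), g; split => //; first exact: addr_ge0.
  by rewrite /g l10.
suff H s t : 0 <= s -> s <= t -> t <= l1 + l2 -> mdist (g s) (g t) = `|s - t|.
  move=> s t /andP[s0 sl] /andP[t0 tl]; case: (leP s t) => st; first exact: H.
  by rewrite metric_sym distrC H// ltW.
move=> s0 st tl; rewrite /g; case: ifPn => sl1; last first.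
  move: sl1; rewrite -ltNge => sl1.
  rewrite leNgt (lt_le_trans sl1 st)/= g2d; last 2 first.
  - by apply/andP; split; lra.
  - by apply/andP; split; lra.
  by congr `|_|; ring.
case: ifPn => tl1.
  by rewrite g1d// ?s0 ?tl1 ?sl1 ?(le_trans s0 st).
move: tl1; rewrite -ltNge => tl1.
have d1 : mdist (g1 s) m = l1 - s.
  by rewrite -g1l g1d ?s0 ?sl1 ?l10 ?lexx// distrC ger0_norm ?subr_ge0.
have d2 : mdist m (g2 (t - l1)) = t - l1.
  rewrite -g20 g2d ?lexx ?l20//; last by apply/andP; split; lra.
  by rewrite sub0r normrN ger0_norm// subr_ge0 ltW.
have d0 : mdist b (g1 s) = s.
  by rewrite -g10 g1d ?lexx ?l10 ?s0 ?sl1// sub0r normrN ger0_norm.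
have d3 : mdist (g2 (t - l1)) c = l1 + l2 - t.
  rewrite -g2l g2d; last 2 first.
  - by apply/andP; split; lra.
  - by rewrite l20 lexx.
  by rewrite distrC ger0_norm; lra.
rewrite distrC ger0_norm ?subr_ge0//; apply/eqP; rewrite eq_le; apply/andP; split.
  by apply: (le_trans (metric_triangle _ m _)); lra.
have := metric_triangle b (g1 s) c.
by have := metric_triangle (g1 s) (g2 (t - l1)) c; lra.
Qed.

Definition pt2 (x y : R) : 'rV[R]_2 := \row_i (if i == ord0 then x else y).

Lemma eucl_dist_pt2 x y x' y' :
  eucl_dist (pt2 x y) (pt2 x' y') = Num.sqrt ((x - x') ^+ 2 + (y - y') ^+ 2).
Proof. by congr Num.sqrt; rewrite big_ord_recl big_ord1 !mxE. Qed.

(** The triangle has vertices (0, 0), (l, 0) and (x, y). The law of cosines dictates [x], and the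
    triangle inequalities bound its absolute value by [p], which makes room for [y]. *)
Lemma comparison_triangle (p q l : R) : 0 < l -> 0 <= p -> 0 <= q ->
  p <= q + l -> q <= p + l -> l <= p + q ->
  exists x y, [/\ x ^+ 2 + y ^+ 2 = p ^+ 2, (l - x) ^+ 2 + y ^+ 2 = q ^+ 2 &
    2 * l * x = p ^+ 2 + l ^+ 2 - q ^+ 2].
Proof.
move=> l0 p0 q0 h1 h2 h3.
pose x := (p ^+ 2 + l ^+ 2 - q ^+ 2) / (2 * l).
have xE : 2 * l * x = p ^+ 2 + l ^+ 2 - q ^+ 2 by rewrite /x; field; lra.
have xp : x <= p by rewrite -(ler_pM2l l0); nra.
have px : - p <= x by rewrite -(ler_pM2l l0); nra.
have xx : x ^+ 2 <= p ^+ 2 by nra.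
exists x, (Num.sqrt (p ^+ 2 - x ^+ 2)); rewrite sqr_sqrtr ?subr_ge0//.
by split => //; [ring|move: xE; clear; nra].
Qed.

(** In the Euclidean plane this is an equality, Stewart's theorem; the CAT(0) inequality compares
    [mdist a m] with the corresponding segment of the comparison triangle. For a midpoint [m] it is,
    up to a factor, the CN inequality of Bruhat and Tits. *)
Lemma CAT0_CN : CAT0_space T -> forall a b c m, mdist b m + mdist m c = mdist b c ->
  mdist b c * mdist a m ^+ 2 <= mdist m c * mdist a b ^+ 2 +
    mdist b m * mdist a c ^+ 2 - mdist b c * (mdist b m * mdist m c).
Proof.
move=> [_ geo cat] a b c m bmc.
have [bc0|bc0] := eqVneq (mdist b c) 0.
  have bm0 : mdist b m = 0 by have := mdist_ge0 b m; have := mdist_ge0 m c; lra.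
  have mc0 : mdist m c = 0 by have := mdist_ge0 b m; have := mdist_ge0 m c; lra.
  by rewrite bc0 bm0 mc0 !mul0r addr0 subr0.
have l0 : 0 < mdist b c by rewrite lt_neqAle eq_sym bc0 mdist_ge0.
have [S1 g1] := geo b m; have [S2 g2] := geo m c.
have [S gS Sm] := concat_geodesic g1 g2 bmc.
have [Sc gSc] := geo c a; have [Sa gSa] := geo a b.
have [x [y [e1 e2 e3]]] : exists x y, [/\ x ^+ 2 + y ^+ 2 = mdist a b ^+ 2,
  (mdist b c - x) ^+ 2 + y ^+ 2 = mdist a c ^+ 2 &
    2 * mdist b c * x = mdist a b ^+ 2 + mdist b c ^+ 2 - mdist a c ^+ 2].
  apply: comparison_triangle => //; rewrite ?mdist_ge0//.
  - by rewrite (metric_sym b c) metric_triangle.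
  - exact: metric_triangle.
  - by rewrite (metric_sym a b) metric_triangle.
have nrm z w : 0 <= w -> z = w ^+ 2 -> Num.sqrt z = w.
  by move=> w0 ->; rewrite sqrtr_sqr ger0_norm.
pose v (i : 'I_3) := nth a [:: b; c; a] i.
pose SS (i : 'I_3) := nth set0 [:: S; Sc; Sa] i.
pose w (i : 'I_3) := nth (pt2 x y) [:: pt2 0 0; pt2 (mdist b c) 0; pt2 x y] i.
have bmx : 0 <= mdist b m by exact: mdist_ge0.
have mcx : 0 <= mdist m c by exact: mdist_ge0.
(* Side 0 carries [m], and [a] is taken as the initial point of side 2. *)
have := cat v SS w _ _ (@Ordinal 3 0 isT) (@Ordinal 3 2 isT) m a
  (pt2 (mdist b m) 0) (pt2 x y).
rewrite /SS/= => /(_ _ _ Sm _ _ _ _ _) H.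
have : mdist m a <= eucl_dist (pt2 (mdist b m) 0) (pt2 x y).
  apply: H.
  - by move=> [[|[|[|//]]] i3].
  - move=> [[|[|[|//]]] i3] [[|[|[|//]]] j3]; rewrite /v/w/= ?eucl_distxx ?mdistxx//.
    + by rewrite eucl_dist_pt2; apply: nrm; rewrite ?mdist_ge0//; ring.
    + by rewrite (metric_sym b a) eucl_dist_pt2; apply: nrm; rewrite ?mdist_ge0// -e1; ring.
    + by rewrite (metric_sym c b) eucl_dist_pt2; apply: nrm; rewrite ?mdist_ge0//; ring.
    + by rewrite (metric_sym c a) eucl_dist_pt2; apply: nrm; rewrite ?mdist_ge0// -e2; ring.
    + by rewrite eucl_dist_pt2; apply: nrm; rewrite ?mdist_ge0// -e1; ring.
    + by rewrite eucl_dist_pt2; apply: nrm; rewrite ?mdist_ge0// -e2; ring.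
  - exists (mdist b m / mdist b c).
      rewrite divr_ge0 ?mdist_ge0//= ler_pdivrMr// mul1r -bmc; lra.
    apply/rowP => i; rewrite !mxE /=; case: ifP => _; last by ring.
    by field.
  - by rewrite eucl_dist_pt2; apply: nrm => //; ring.
  - by case: gSa => l [g [l0' g0 _ _ ->]]; exists 0 => //=; rewrite lexx.
  - exists 0; first by rewrite lexx ler01.
    by rewrite subr0 scale1r scale0r addr0.
  - by rewrite eucl_distxx mdistxx.
rewrite metric_sym -(@ler_pXn2r _ 2)// ?nnegrE ?mdist_ge0 ?eucl_dist_ge0//.
rewrite eucl_dist_pt2 sqr_sqrtr ?addr_ge0 ?sqr_ge0// => H1.
apply: (le_trans (ler_wpM2l (ltW l0) H1)).
have -> : mdist b c * ((mdist b m - x) ^+ 2 + (0 - y) ^+ 2) =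
  mdist b c * mdist b m ^+ 2 - mdist b m * (2 * mdist b c * x) +
  mdist b c * (x ^+ 2 + y ^+ 2) by ring.
rewrite e1 e3 (_ : mdist m c = mdist b c - mdist b m); last by lra.
by rewrite le_eqVlt; apply/orP; left; apply/eqP; ring.
Qed.

End CAT0.

(** After [CAT0_complex_dist] the CAT(0) hypothesis is used in this form only. [cm_chain] and
    [cm_approx] together make [D] the infimum of the lengths of broken lines. *)
Record cat0_dist (R : realType) (K : fin_cube_complex R)
    (D : complex_point K -> complex_point K -> R) : Prop := Cat0Dist {
  cm_refl : forall x, D x x = 0;
  cm_eq0 : forall x y, D x y = 0 -> x = y;
  cm_sym : forall x y, D x y = D y x;
  cm_tri : forall y x z, D x z <= D x y + D y z;
  cm_chain : forall x y l, chain_of_length x y l -> D x y <= l;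
  cm_approx : forall x y r, D x y < r -> exists2 l, l < r & chain_of_length x y l;
  cm_between : forall x y s, 0 <= s <= D x y ->
    exists z, D x z = s /\ D z y = D x y - s;
  cm_CN : forall a b c m, D b m + D m c = D b c ->
    D b c * D a m ^+ 2 <= D m c * D a b ^+ 2 + D b m * D a c ^+ 2 -
      D b c * (D b m * D m c)
}.

Lemma CAT0_complex_dist (R : realType) (K : fin_cube_complex R) :
  CAT0_complex K -> inhabited (complex_point K) /\
  exists D : complex_point K -> complex_point K -> R, cat0_dist D.
Proof.
move=> [T [f [[g fK gK] fd catT]]]; have [[p _] geo _] := catT.
split; first by constructor; exact: (g p).
exists (fun x y => mdist (f x) (f y)); split.
- by move=> x; exact: mdistxx.
- by move=> x y /mdist_positivity/(can_inj fK).
- by move=> x y; exact: metric_sym.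
- by move=> y x z; exact: metric_triangle.
- move=> x y l xy; rewrite -lee_fin fd; apply: ereal_inf_lbound.
  by exists l.
- move=> x y r; rewrite -lte_fin fd => /ereal_inf_lt[_ [l xy <-]].
  by rewrite lte_fin => lr; exists l.
- move=> x y s /andP[s0 sl].
  have [S [l [h [l0 h0 hl hd _]]]] := geo (f x) (f y).
  have xyE : mdist (f x) (f y) = l.
    by rewrite -h0 -hl hd ?lexx ?l0// sub0r normrN ger0_norm.
  rewrite xyE in sl *; exists (g (h s)); rewrite gK.
  rewrite -[in mdist (f x) _]h0 -[in mdist _ (f y)]hl !hd ?lexx ?l0 ?s0 ?sl//.
  by rewrite sub0r normrN ger0_norm// distrC ger0_norm ?subr_ge0.
- by move=> a b c m; exact: CAT0_CN.
Qed.

(** * Stars and retractions *)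

Lemma finite_pos_bound (R : realType) (I : finType) (P : I -> R -> Prop) :
  (forall i, exists2 d, 0 < d & P i d) ->
  (forall i d d', d' <= d -> P i d -> P i d') ->
  exists2 d, 0 < d & forall i, P i d.
Proof.
move=> H mono.
have /choice[e eP] : forall i, exists d, 0 < d /\ P i d.
  by move=> i; have [d ? ?] := H i; exists d.
exists (\big[Num.min/1]_i e i).
  by elim/big_ind : _ => // [x y x0 y0|i _]; [rewrite lt_min x0|have [] := eP i].
move=> i; apply: mono (eP i).2; exact: bigmin_le.
Qed.

Section Star.
Variables (R : realType) (K : fin_cube_complex R).
Implicit Types (c : cell K) (p y : complex_point K).

(** [d] bounds from below the distance from [p] to those facets of cells through [p] that miss [p];
    hence a path from [p] of length less than [d] stays in the star of [p]. *)
Definition small (d : R) p := forall c (u : 'rV[R]_(cell_dim c)),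
  unit_cube R _ u -> chart u = p ->
  forall i (b : bool), u ord0 i != (b : nat)%:R -> d <= `|u ord0 i - (b : nat)%:R|.

Lemma exists_small p : exists2 d, 0 < d & small d p.
Proof.
apply: (@finite_pos_bound R _ (fun c d => forall u : 'rV[R]_(cell_dim c),
  unit_cube R _ u -> chart u = p -> forall i (b : bool),
  u ord0 i != (b : nat)%:R -> d <= `|u ord0 i - (b : nat)%:R|)); last first.
  by move=> c d d' dd' H u cu up i b ub; exact: le_trans dd' (H _ _ _ _ _ _).
move=> c; have [[u cu up]|pc] := pselect (carrier c p); last first.
  by exists 1 => // u cu up; exfalso; apply: pc; exists u.
have [[i b]|ib d d'|d d0 H] := @finite_pos_bound R ('I_(cell_dim c) * bool)%type
  (fun ib d => u ord0 ib.1 != (ib.2 : nat)%:R ->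
    d <= `|u ord0 ib.1 - (ib.2 : nat)%:R|).
- have [E|E] := eqVneq (u ord0 i) (b : nat)%:R; first by exists 1.
  by exists `|u ord0 i - (b : nat)%:R| => //; rewrite normr_gt0 subr_eq0.
- by move=> dd' H /H; exact: le_trans.
- exists d => // u' cu' u'p i b; have <- : u = u' by apply: chart_inj => //; rewrite up.
  exact: (H (i, b)).
Qed.

(** A coordinate of [w] frozen in the common face of [c] and [c'] has the same value at [u]:
    otherwise [u] would be at distance at least [d] from a facet containing [w]. *)
Lemma small_star d p c c' (u w : 'rV[R]_(cell_dim c')) : small d p ->
  unit_cube R _ u -> unit_cube R _ w -> chart u = p ->
  eucl_dist w u < d -> carrier c (chart w) -> carrier c p.
Proof.
move=> sd cu cw up wu cy.
have [a aP] := common_face (carrier_chart cw) cy.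
have fw : cube_face R a w by apply/aP.
rewrite -up; apply/aP => //; split=> // i b ai; apply/eqP/negPn/negP => ui.
have := sd _ _ cu up _ _ ui; rewrite -(fw.2 _ _ ai) distrC => du.
have := coord_le_eucl_dist w u i; lra.
Qed.

Lemma chain_ge0 x y (l : R) : @chain_of_length R K x y l -> 0 <= l.
Proof. by elim=> // *; rewrite addr_ge0 ?eucl_dist_ge0. Qed.

(** By induction each segment of the broken line lies in a cell through [p], where the triangle
    inequality bounds the distance to [p]. *)
Lemma star_chain d p y y' l : small d p -> @chain_of_length R K y y' l ->
  forall c (u w : 'rV[R]_(cell_dim c)), unit_cube R _ u -> unit_cube R _ w ->
    chart u = p -> chart w = y -> eucl_dist w u + l < d ->
  exists c' (u' w' : 'rV[R]_(cell_dim c')),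
    [/\ unit_cube R _ u', unit_cube R _ w', chart u' = p, chart w' = y' &
      eucl_dist w' u' <= eucl_dist w u + l].
Proof.
move=> sd; elim=> {y y' l} [y|c1 u1 v1 y' l cu1 cv1 ch IH] c u w cu cw up wy lt.
  by exists c, u, w; split=> //; rewrite addr0.
have l0 := chain_ge0 ch.
have [||up1 cup1 up1p] := @small_star d p c1 c u w sd cu cw up.
- by have := eucl_dist_ge0 u1 v1; lra.
- by rewrite wy; exact: carrier_chart.
have wu : eucl_dist w u = eucl_dist u1 up1 by apply: glue_dist; rewrite ?up1p.
have tri := eucl_dist_triangle v1 u1 up1; rewrite (eucl_distC v1 u1) in tri.
have [||c' [u' [w' [? ? ? ? le']]]] := IH _ up1 v1 cup1 cv1 up1p; first by [].
  by lra.
by exists c', u', w'; split=> //; lra.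
Qed.

Definition proj_face n (a : 'I_n -> option bool) (w : 'rV[R]_n) : 'rV[R]_n :=
  \row_k (if a k is Some b then (b : nat)%:R else w ord0 k).

Lemma proj_faceP n (a : 'I_n -> option bool) w :
  unit_cube R n w -> cube_face R a (proj_face a w).
Proof.
move=> cw; split=> [k|k b]; rewrite mxE; last by move=> ->.
by case: (a k) => [b|//]; exact: bool01.
Qed.

Lemma proj_face_lip n (a : 'I_n -> option bool) w w' :
  eucl_dist (proj_face a w) (proj_face a w') <= eucl_dist w w'.
Proof.
apply: ler_wsqrtr; apply: ler_sum => k _; rewrite !mxE; case: (a k) => // b.
by rewrite subrr expr0n sqr_ge0.
Qed.

Lemma proj_face_pyth n (a : 'I_n -> option bool) w z : cube_face R a z ->
  eucl_dist w z ^+ 2 =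
  eucl_dist w (proj_face a w) ^+ 2 + eucl_dist (proj_face a w) z ^+ 2.
Proof.
move=> [_ fz]; rewrite !eucl_dist_sqr -big_split/=; apply: eq_bigr => k _.
rewrite !mxE; case ak : (a k) => [b|]; last by rewrite subrr expr0n add0r.
by rewrite (fz _ _ ak) subrr expr0n addr0.
Qed.

(* The retraction of the star of p onto the cell c: on another cell c' of the
   star it is the orthogonal projection to the common face of c and c'. *)
Definition star_retract p c y (z : 'rV[R]_(cell_dim c)) : Prop :=
  exists c' (a : 'I_(cell_dim c') -> option bool) (w : 'rV[R]_(cell_dim c')),
  [/\ carrier c' p, unit_cube R _ w /\ chart w = y,
      (forall u, unit_cube R _ u -> carrier c (chart u) <-> cube_face R a u),
      unit_cube R _ z & chart z = chart (proj_face a w)].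

Lemma star_retract_exists p c c' : carrier c p -> carrier c' p ->
  exists a : 'I_(cell_dim c') -> option bool,
  forall w : 'rV[R]_(cell_dim c'), unit_cube R _ w ->
  exists2 z : 'rV[R]_(cell_dim c), star_retract p (chart w) z &
    chart z = chart (proj_face a w).
Proof.
move=> cp c'p; have [a aP] := common_face c'p cp; exists a => w cw.
have fw := proj_faceP a cw.
have [z cz zE] : carrier c (chart (proj_face a w)) by apply/aP => //; exact: fw.1.
by exists z => //; exists c', a, w; split.
Qed.

(** The projections computed in two cells containing [y] lie in both cells, and each is nearest to
    [y] in its face; Pythagoras in the two cells forces them to coincide. *)
Lemma star_retract_uniq p c y (z z' : 'rV[R]_(cell_dim c)) :
  carrier c p -> star_retract p y z -> star_retract p y z' -> z = z'.
Proof.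
move=> cp [c1 [a1 [w1 [c1p [cw1 w1y] a1P cz zE]]]].
move=> [c2 [a2 [w2 [c2p [cw2 w2y] a2P cz' z'E]]]].
suff swap c3 c4 (a3 : 'I_(cell_dim c3) -> option bool) (w3 : 'rV[R]_(cell_dim c3))
    (a4 : 'I_(cell_dim c4) -> option bool) (w4 : 'rV[R]_(cell_dim c4)) :
    carrier c3 p -> carrier c4 p -> unit_cube R _ w3 -> unit_cube R _ w4 ->
    chart w3 = chart w4 ->
    (forall u, unit_cube R _ u -> carrier c (chart u) <-> cube_face R a3 u) ->
    (forall u, unit_cube R _ u -> carrier c (chart u) <-> cube_face R a4 u) ->
    exists2 x, cube_face R a4 x & chart x = chart (proj_face a3 w3).
  have w12 : chart w1 = chart w2 by rewrite w1y.
  have [x2 f2 x2E] := swap _ _ _ _ _ _ c1p c2p cw1 cw2 w12 a1P a2P.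
  have [x1 f1 x1E] := swap _ _ _ _ _ _ c2p c1p cw2 cw1 (esym w12) a2P a1P.
  have P1 := proj_face_pyth w1 f1; have P2 := proj_face_pyth w2 f2.
  have E1 : eucl_dist w1 (proj_face a1 w1) = eucl_dist w2 x2.
    by apply: glue_dist => //; [exact: (proj_faceP a1 cw1).1|exact: f2.1].
  have E2 : eucl_dist w1 x1 = eucl_dist w2 (proj_face a2 w2).
    by apply: glue_dist => //; [exact: f1.1|exact: (proj_faceP a2 cw2).1].
  have /eqP : eucl_dist (proj_face a1 w1) x1 ^+ 2 = 0.
    apply/eqP; rewrite eq_le sqr_ge0 andbT.
    by have := sqr_ge0 (eucl_dist (proj_face a2 w2) x2); rewrite -E1 -E2 in P1 P2 *; lra.
  rewrite sqrf_eq0 => /eqP/eucl_dist_eq0 pE.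
  by apply: chart_inj => //; rewrite zE pE x1E z'E.
move=> c3p c4p cw3 cw4 w34 a3P a4P.
have [b bP] := common_face c3p c4p.
have fb w : unit_cube R _ w -> carrier c4 (chart w) -> cube_face R b w.
  by move=> cw c4w; apply/bP.
have fw3 : cube_face R b w3 by apply: fb; rewrite ?w34//; exact: carrier_chart.
have fp := proj_faceP a3 cw3.
have [up cup upE] := c3p.
have fup3 : cube_face R a3 up by apply/a3P; rewrite ?upE.
have fupb : cube_face R b up by apply: fb; rewrite ?upE.
(* Each coordinate of the projection is that of [p] or that of [w3], and both points lie in the
   common face [b] of [c3] and [c4]. *)
have fpb : cube_face R b (proj_face a3 w3).
  split=> [|k e bk]; first exact: fp.1.
  rewrite mxE; case a3k : (a3 k) => [e'|]; last exact: fw3.2.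
  by rewrite -(fup3.2 _ _ a3k) (fupb.2 _ _ bk).
have [x cx xE] : carrier c4 (chart (proj_face a3 w3)) by apply/bP => //; exact: fp.1.
exists x => //; apply/a4P => //; rewrite xE; apply/a3P => //; exact: fp.1.
Qed.

Lemma star_retract_lip p c c' (w w' : 'rV[R]_(cell_dim c')) z z' :
  carrier c p -> carrier c' p -> unit_cube R _ w -> unit_cube R _ w' ->
  @star_retract p c (chart w) z -> @star_retract p c (chart w') z' ->
  eucl_dist z z' <= eucl_dist w w'.
Proof.
move=> cp c'p cw cw' zw zw'.
have [a aE] := star_retract_exists cp c'p.
have [z1 zw1 z1E] := aE _ cw; have [z2 zw2 z2E] := aE _ cw'.
rewrite (star_retract_uniq cp zw zw1) (star_retract_uniq cp zw' zw2).
apply: le_trans (proj_face_lip a w w'); rewrite le_eqVlt; apply/orP; left.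
have [? [? [? [_ _ _ cz1 _]]]] := zw1; have [? [? [? [_ _ _ cz2 _]]]] := zw2.
by apply/eqP/glue_dist => //; exact: (proj_faceP a _).1.
Qed.

Lemma star_retract_id p c z : carrier c p -> unit_cube R _ z ->
  @star_retract p c (chart z) z.
Proof.
move=> cp cz; exists c, (@whole R K c), z; split=> //.
  by move=> u cu; rewrite whole_face; split=> // _; exact: carrier_chart.
by congr chart; apply/rowP => k; rewrite mxE.
Qed.

Lemma star_retract_chain d p c y y' l : small d p -> carrier c p ->
  @chain_of_length R K y y' l ->
  forall c1 (u w : 'rV[R]_(cell_dim c1)) z z',
    unit_cube R _ u -> unit_cube R _ w ->
    chart u = p -> chart w = y -> eucl_dist w u + l < d ->
    @star_retract p c y z -> @star_retract p c y' z' -> eucl_dist z z' <= l.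
Proof.
move=> sd cp; elim=> {y y' l} [y|c1 u1 v1 y' l cu1 cv1 ch IH] c0 u w z z' cu cw up wy lt.
  by move=> zy z'y; rewrite (star_retract_uniq cp zy z'y) eucl_distxx.
have l0 := chain_ge0 ch; move=> zy z'y.
have [||up1 cup1 up1p] := @small_star d p c1 c0 u w sd cu cw up.
- by have := eucl_dist_ge0 u1 v1; lra.
- by rewrite wy; exact: carrier_chart.
have wu : eucl_dist w u = eucl_dist u1 up1 by apply: glue_dist; rewrite ?up1p.
have c1p : carrier c1 p by exists up1.
have tri := eucl_dist_triangle v1 u1 up1; rewrite (eucl_distC v1 u1) in tri.
have [a /(_ _ cv1)[zv zvy _]] := star_retract_exists cp c1p.
have H1 := star_retract_lip cp c1p cu1 cv1 zy zvy.
have H2 : eucl_dist zv z' <= l.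
  by apply: (IH _ up1 v1 zv z') => //; lra.
by have := eucl_dist_triangle z zv z'; lra.
Qed.

Variable D : complex_point K -> complex_point K -> R.
Hypothesis hD : cat0_dist D.

Lemma dist_le_eucl c (u v : 'rV[R]_(cell_dim c)) :
  unit_cube R _ u -> unit_cube R _ v -> D (chart u) (chart v) <= eucl_dist u v.
Proof.
move=> cu cv; apply: (cm_chain hD); rewrite -[eucl_dist _ _]addr0.
by apply: chain_step => //; exact: chain_nil.
Qed.

Lemma dist_ge0 x y : 0 <= D x y.
Proof.
by have := cm_tri hD y x x; rewrite (cm_refl hD) (cm_sym hD y x); lra.
Qed.

(** Broken lines of length close to [D p y] give cells in which [p] and [y] are at almost this
    distance. The Euclidean distance of two points is the same in every cell containing both, so the
    value is attained. *)
Lemma near_star d p y : small d p -> D p y < d ->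
  exists c (u w : 'rV[R]_(cell_dim c)),
  [/\ unit_cube R _ u, unit_cube R _ w, chart u = p, chart w = y &
      eucl_dist u w = D p y].
Proof.
move=> sd py.
have H r : D p y < r -> r <= d -> exists c (u w : 'rV[R]_(cell_dim c)),
    [/\ unit_cube R _ u, unit_cube R _ w, chart u = p, chart w = y &
      eucl_dist u w < r].
  move=> /(cm_approx hD)[l lr ch] rd; have [c0 [u0 cu0 u0p]] := chart_cover p.
  have [|c [u [w [? ? ? ? le]]]] := star_chain sd ch cu0 cu0 u0p u0p.
    by rewrite eucl_distxx; lra.
  exists c, u, w; split=> //; rewrite eucl_distC.
  by rewrite eucl_distxx add0r in le; lra.
have [c [u [w [cu cw up wy _]]]] := H d py (lexx d).
have le_D : D p y <= eucl_dist u w by rewrite -up -wy; exact: dist_le_eucl.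
exists c, u, w; split=> //; apply/eqP; rewrite eq_le le_D andbT leNgt.
apply/negP => lt; have [||c' [u' [w' [? ? u'p w'y]]]] := H (Num.min (eucl_dist u w) d).
- by rewrite lt_min py lt.
- by rewrite ge_min lexx orbT.
rewrite lt_min => /andP[+ _].
by rewrite (@glue_dist _ _ c' c u' w' u w) ?ltxx// ?u'p ?w'y.
Qed.

Lemma star_retract_dist d p c c1 (u w : 'rV[R]_(cell_dim c1)) y z z' :
  small d p -> carrier c p -> unit_cube R _ u -> unit_cube R _ w ->
  chart u = p -> eucl_dist w u + D (chart w) y < d ->
  @star_retract p c (chart w) z -> @star_retract p c y z' ->
  eucl_dist z z' <= D (chart w) y.
Proof.
move=> sd cp cu cw up lt zy z'y; rewrite leNgt; apply/negP => lt'.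
have [|l ll ch] := @cm_approx _ _ _ hD (chart w) y
    (Num.min (eucl_dist z z') (d - eucl_dist w u)).
  by rewrite lt_min lt'/=; lra.
move: ll; rewrite lt_min => /andP[lz ld].
have : eucl_dist z z' <= l.
  by apply: (star_retract_chain sd cp ch cu cw up erefl _ zy z'y); lra.
lra.
Qed.

(** The retraction onto [c] fixes [c] and does not increase lengths, so leaving [c] gives no
    shortcut. The radius [d / 4] keeps the competing broken lines in the star. *)
Lemma local_eucl d p c (u w w' : 'rV[R]_(cell_dim c)) : small d p ->
  unit_cube R _ u -> unit_cube R _ w -> unit_cube R _ w' -> chart u = p ->
  eucl_dist w u < d / 4 -> eucl_dist w' u < d / 4 ->
  D (chart w) (chart w') = eucl_dist w w'.
Proof.
move=> sd cu cw cw' up wu w'u; apply/eqP; rewrite eq_le dist_le_eucl//=.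
have cp : carrier c p by exists u.
apply: (star_retract_dist sd cp cu cw up); try exact: star_retract_id.
have := dist_le_eucl cw cw'; have := eucl_dist_triangle w u w'.
have := eucl_dist_ge0 w u; rewrite (eucl_distC u w'); lra.
Qed.

End Star.

(** * Convexity of cells *)

Section CellsConvex.
Variables (R : realType) (K : fin_cube_complex R).
Variable D : complex_point K -> complex_point K -> R.
Hypothesis hD : cat0_dist D.
Implicit Types (c : cell K) (p y : complex_point K).

Lemma between_split x y z (r s : R) : D x y <= r -> D y z <= s -> D x z = r + s ->
  D x y = r /\ D y z = s.
Proof. by move=> xy yz xz; have := cm_tri hD y x z; lra. Qed.

(* A straight segment is a local geodesic, and local geodesics of CAT(0) spaces
   are geodesics. *)
Lemma dist_cell c (u v : 'rV[R]_(cell_dim c)) :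
  unit_cube R _ u -> unit_cube R _ v -> D (chart u) (chart v) = eucl_dist u v.
Proof.
move=> cu cv; set L := eucl_dist u v.
have [L0|L0] := eqVneq L 0.
  by rewrite L0 -(eucl_dist_eq0 L0) (cm_refl hD).
have Lp : 0 < L by rewrite lt_neqAle eq_sym L0 eucl_dist_ge0.
pose w s := u + s *: (v - u).
have cw s : 0 <= s <= 1 -> unit_cube R _ (w s) by exact: cube_convex.
have ww s t : eucl_dist (w s) (w t) = `|s - t| * L by exact: eucl_dist_along.
have w0 : w 0 = u by rewrite /w scale0r addr0.
have w1 : w 1 = v by rewrite /w scale1r addrC subrK.
have Dw s t : 0 <= s -> s <= t -> t <= 1 -> D (chart (w s)) (chart (w t)) <= (t - s) * L.
  move=> s0 st t1; have -> : (t - s) * L = eucl_dist (w s) (w t).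
    by rewrite ww distrC ger0_norm ?subr_ge0.
  by apply: dist_le_eucl => //; apply: cw; apply/andP; split; lra.
(* [B] collects the parameters up to which the segment realizes the distance. It contains its
   supremum [s], and [s < 1] is refuted by an extension past [s]. *)
pose B := [set s : R | 0 <= s <= 1 /\ D (chart u) (chart (w s)) = s * L].
have B0 : B 0 by split; rewrite ?lexx ?ler01// w0 (cm_refl hD) mul0r.
have hsB : has_sup B by split; [exists 0|exists 1 => s [/andP[]]].
set s := sup B.
have s0 : 0 <= s by exact: (sup_upper_bound hsB).
have s1 : s <= 1 by apply: ge_sup => [|t [/andP[]]]//; exists 0.
have Bs : B s.
  split; first by rewrite s0.
  apply/eqP; rewrite eq_le; apply/andP; split.
    by have := Dw 0 s (lexx 0) s0 s1; rewrite w0 subr0.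
  apply/ler_addgt0Pr => e e0.
  have L2 : 0 < 2 * L by rewrite mulr_gt0.
  have [t [/andP[t0 t1] tE] st] := sup_adherent (divr_gt0 e0 L2) hsB.
  have ts : t <= s by apply: (sup_upper_bound hsB); split; rewrite ?t0.
  have := cm_tri hD (chart (w s)) (chart u) (chart (w t)).
  rewrite tE (cm_sym hD (chart (w s))) => tri; have := Dw t s t0 ts s1.
  rewrite -/s in st.
  have : (s - t) * (2 * L) < e by rewrite -ltr_pdivlMr//; lra.
  lra.
apply: contrapT => uv; have {uv s1} s1 : s < 1.
  rewrite lt_neqAle s1 andbT; apply/eqP => sE; apply: uv.
  by have := Bs.2; rewrite sE w1 mul1r.
have cws : unit_cube R _ (w s) by apply: cw; rewrite s0 ltW.
have [d d0 sd] := exists_small (chart (w s)).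
pose e := Num.min (1 - s) (d / (8 * L)).
have e0 : 0 < e by rewrite lt_min subr_gt0 s1 divr_gt0// mulr_gt0.
have es : e <= 1 - s by rewrite ge_min lexx.
have eL : e * L < d / 4.
  have : e <= d / (8 * L) by rewrite ge_min lexx orbT.
  rewrite ler_pdivlMr ?mulr_gt0// => H; lra.
have loc t t' : 0 <= t <= 1 -> 0 <= t' <= 1 -> `|t - s| <= e -> `|t' - s| <= e ->
    D (chart (w t)) (chart (w t')) = `|t - t'| * L.
  move=> t01 t'01 ts t's; rewrite -ww.
  apply: (local_eucl hD sd cws (cw _ t01) (cw _ t'01) erefl); rewrite ww.
    by apply: le_lt_trans eL; rewrite ler_wpM2r// ltW.
  by apply: le_lt_trans eL; rewrite ler_wpM2r// ltW.
suff [r [r0 re Br]] : exists r,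
    [/\ 0 < r, r <= e & D (chart u) (chart (w (s + r))) = (s + r) * L].
  have : s + r <= s by apply: (sup_upper_bound hsB); split=> //; apply/andP; split; lra.
  lra.
have [s00|sn0] := eqVneq s 0.
  exists e; split=> //; rewrite -[in LHS]w0 loc; last 4 first.
  - by rewrite lexx ler01.
  - by apply/andP; split; lra.
  - by rewrite s00 subrr normr0 ltW.
  - by rewrite addrAC subrr add0r gtr0_norm.
  by rewrite sub0r normrN ger0_norm//; lra.
have sp : 0 < s by rewrite lt_neqAle eq_sym sn0.
pose r := Num.min e s.
have r0 : 0 < r by rewrite lt_min e0.
have re : r <= e by rewrite ge_min lexx.
have rs : r <= s by rewrite ge_min lexx orbT.
clearbody r; exists r; split=> //.
have Dus : D (chart u) (chart (w s)) = (s - r) * L + r * L by rewrite Bs.2; ring.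
have [||Dbm Dmc] := @between_split (chart u) (chart (w (s - r))) (chart (w s)) _ _ _ _ Dus.
- by have := Dw 0 (s - r); rewrite w0 subr0; apply; lra.
- by have := Dw (s - r) s; rewrite subKr; apply; lra.
(* The triangle is [w (s + r)], [u], [w s], with the point [w (s - r)] on its side. Locally
   [w (s - r)] and [w (s + r)] are at distance [2 * r * L], and the CN inequality then bounds the
   distance from [u] to [w (s + r)] below by [(s + r) * L]. *)
have := cm_CN hD (chart (w (s + r))) (etrans (congr2 +%R Dbm Dmc) (esym Dus)).
rewrite Dbm Dmc Bs.2 loc; last 4 first.
- by apply/andP; split; lra.
- by apply/andP; split; lra.
- by rewrite addrAC subrr add0r gtr0_norm.
- by rewrite addrAC subrr add0r normrN gtr0_norm.
rewrite (cm_sym hD _ (chart u)) (_ : `|s + r - (s - r)| = 2 * r); last first.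
  by rewrite ger0_norm; lra.
have := Dw s (s + r); rewrite (cm_sym hD (chart (w s))) addrAC subrr add0r.
move=> /(_ s0) H; have {H} : D (chart (w (s + r))) (chart (w s)) <= r * L by apply: H; lra.
have := Dw 0 (s + r); rewrite w0 subr0 => H.
have {H} : D (chart u) (chart (w (s + r))) <= (s + r) * L by apply: H; lra.
have := dist_ge0 hD (chart (w (s + r))) (chart (w s)).
have := dist_ge0 hD (chart u) (chart (w (s + r))).
move: (D _ _) (D _ _) => Y X X0 Y0 XL YL CN.
apply/eqP; rewrite eq_le XL/= -(@ler_pXn2r _ 2)// ?nnegrE; last first.
  by apply: mulr_ge0; lra.
rewrite -(ler_pM2l (mulr_gt0 r0 Lp)).
have rL0 : 0 <= r * L by rewrite mulr_ge0// ltW.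
have YY : Y ^+ 2 <= (r * L) ^+ 2 by move: Y0 YL rL0; clear; nra.
have sr : 0 <= (s - r) * L by apply: mulr_ge0; lra.
have := ler_wpM2l sr YY => YY'.
apply: (@le_trans _ _ (s * L * (2 * r * L) ^+ 2 - (s - r) * L * (r * L) ^+ 2
   + s * L * ((s - r) * L * (r * L)))); last by lra.
by rewrite le_eqVlt; apply/orP; left; apply/eqP; ring.
Qed.

End CellsConvex.

(** * Lipschitz continuity *)

Section Lipschitz.
Variable R : realType.

(** The retraction onto the unit interval: composing with it extends to all of the line a function
    that is controlled on this interval only. *)
Definition clamp (t : R) : R := Num.max 0 (Num.min 1 t).

Lemma clamp01 t : 0 <= clamp t <= 1.
Proof. by rewrite /clamp le_max lexx ge_max ler01 ge_min lexx. Qed.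

Lemma clamp_id t : 0 <= t <= 1 -> clamp t = t.
Proof. by move=> /andP[t0 t1]; rewrite /clamp (min_idPr t1) (max_idPr t0). Qed.

Lemma clamp_lip s t : `|clamp s - clamp t| <= `|s - t|.
Proof.
have H1 := ler_norm (s - t); have H2 := ler_norm (t - s); rewrite distrC in H2.
rewrite /clamp; case: (leP 1 s) => s1; case: (leP 1 t) => t1;
  rewrite ?(max_idPr ler01); try case: (leP 0 s) => s0; try case: (leP 0 t) => t0;
  rewrite ?subrr ?normr0 ?normr_ge0// ler_norml; lra.
Qed.

Lemma lipschitz_continuous (C : R) (g : R -> R) :
  (forall s t, `|g s - g t| <= C * `|s - t|) -> continuous g.
Proof.
move=> H s; apply/cvgrPdist_lt => e e0.
have C0 : 0 < `|C| + 1 by have := normr_ge0 C; lra.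
near=> t; apply: le_lt_trans (H _ _) _.
apply: (@le_lt_trans _ _ ((`|C| + 1) * `|s - t|)).
  by rewrite ler_wpM2r//; have := ler_norm C; lra.
rewrite mulrC -ltr_pdivlMr//; near: t.
by apply: (@cvgr_dist_lt _ R^o); [exact: cvg_id|rewrite divr_gt0].
Unshelve. all: by end_near. Qed.

Lemma eucl_lipschitz_continuous n (g : 'rV[R]_n -> R) :
  (forall u v, `|g u - g v| <= eucl_dist u v) -> continuous g.
Proof.
move=> H u A /(nbhs_ballP (g u))[e e0 eA]; rewrite /= in e0.
have n0 : 0 < n.+1%:R :> R by rewrite ltr0n.
(* Balls are those of the sup norm; dividing by [n.+1] keeps the Euclidean bound strict and covers
   [n = 0]. *)
have d0 : 0 < e / n.+1%:R by rewrite divr_gt0.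
apply/nbhs_ballP; exists (e / n.+1%:R) => //= v [_ uv]; apply: eA.
apply: le_lt_trans (H _ _) _; rewrite -(@ltr_pXn2r _ 2)// ?nnegrE ?eucl_dist_ge0 ?ltW//.
rewrite eucl_dist_sqr.
apply: (@le_lt_trans _ _ (\sum_(i < n) (e / n.+1%:R) ^+ 2)).
  apply: ler_sum => i _; rewrite -[X in X <= _]real_normK ?num_real//.
  by apply: lerXn2r; rewrite ?nnegrE ?normr_ge0 ?(ltW d0)//; exact/ltW/uv.
rewrite sumr_const card_ord -mulr_natl -[in ltRHS](divfK (lt0r_neq0 n0) e).
have := exprn_gt0 2 d0; have n1 : n%:R + 1 = n.+1%:R :> R by rewrite natr1.
by have := ler0n R n; rewrite -n1; nra.
Qed.

Definition clampv n (u : 'rV[R]_n) : 'rV[R]_n := \row_k clamp (u ord0 k).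

Lemma clampv_cube n u : unit_cube R n (clampv u).
Proof. by move=> k; rewrite mxE clamp01. Qed.

Lemma clampv_id n u : unit_cube R n u -> clampv u = u.
Proof. by move=> cu; apply/rowP => k; rewrite mxE clamp_id. Qed.

Lemma clampv_lip n (u v : 'rV[R]_n) : eucl_dist (clampv u) (clampv v) <= eucl_dist u v.
Proof.
apply: ler_wsqrtr; apply: ler_sum => k _; rewrite !mxE.
by rewrite -[X in X <= _]real_normK ?num_real// -[leRHS]real_normK ?num_real//
  ler_pXn2r ?nnegrE// clamp_lip.
Qed.

Lemma unit_cube_compact n : compact (unit_cube R n).
Proof.
have -> : unit_cube R n = [set v : 'rV[R]_n | forall i, `[(0 : R), 1]%classic (v ord0 i)].
  by apply/seteqP; split=> v cv i; have := cv i; rewrite /= in_itv.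
by apply: (@rV_compact R n (fun=> `[(0 : R), 1]%classic)) => i; exact: segment_compact.
Qed.

End Lipschitz.

(** * Distance to a vertex *)

Section Vertices.
Variables (R : realType) (K : fin_cube_complex R).
Implicit Types (c : cell K) (p : complex_point K).

Definition is_vertex p := exists2 c, cell_dim c = 0%N & carrier c p.

(** By [glue_line] a fractional coordinate would yield a coordinate of a cell of dimension 0. *)
Lemma vertex_binary p c (u : 'rV[R]_(cell_dim c)) :
  is_vertex p -> unit_cube R _ u -> chart u = p -> binary u.
Proof.
move=> [c0 c00 [v cv vp]] cu up i; apply: contrapT => /not_orP[/eqP ui0 /eqP ui1].
have /andP[u0 u1] := cu i.
have ui : 0 < u ord0 i < 1 by rewrite !lt_neqAle ui1 u0 u1 eq_sym ui0.
have [|[j jlt] _] := glue_line cu cv _ ui; first by rewrite up vp.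
by rewrite c00 in jlt.
Qed.

Lemma binary_vertex c (u : 'rV[R]_(cell_dim c)) :
  unit_cube R _ u -> binary u -> is_vertex (chart u).
Proof.
move=> cu bu; pose a i := Some (u ord0 i == 1).
have fu : cube_face R a u.
  split=> // i b [<-]; case: (bu i) => ->; rewrite ?eqxx//.
  by rewrite eq_sym oner_eq0.
have [c0 c0E] := face_cell a; rewrite -/(carrier c0) in c0E.
exists c0; last by rewrite c0E; exists u.
by rewrite (cell_dim_face c0E); exact: eq_card0.
Qed.

End Vertices.

(** * Distance to the base vertex along coordinate lines *)

Section BasePoint.
Variables (R : realType) (K : fin_cube_complex R).
Variable D : complex_point K -> complex_point K -> R.
Hypothesis hD : cat0_dist D.
Variable x : complex_point K.
Hypothesis x_vertex : is_vertex x.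
Implicit Types (c : cell K) (p y : complex_point K).

Local Notation f c u := (D x (@chart R K c u)).

Lemma dist_lip c (u v : 'rV[R]_(cell_dim c)) : unit_cube R _ u -> unit_cube R _ v ->
  `|f c u - f c v| <= eucl_dist u v.
Proof.
move=> cu cv; have := dist_cell hD cu cv.
have := cm_tri hD (chart u) x (chart v); have := cm_tri hD (chart v) x (chart u).
by rewrite (cm_sym hD (chart v)) ler_norml => ? ? <-; lra.
Qed.

(** Cells being convex, a full coordinate line is a geodesic of length 1, to which the CN inequality
    applies. The term [- t * (1 - t)] gives strict convexity. *)
Lemma dist_line_convex c (u : 'rV[R]_(cell_dim c)) i t : unit_cube R _ u ->
  0 <= t <= 1 -> f c (upd u i t) ^+ 2 <=
    (1 - t) * f c (upd u i 0) ^+ 2 + t * f c (upd u i 1) ^+ 2 - t * (1 - t).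
Proof.
move=> cu t01; have /andP[t0 t1] := t01.
have E s r : 0 <= s <= 1 -> 0 <= r <= 1 ->
    D (chart (upd u i s)) (chart (upd u i r)) = `|s - r|.
  by move=> s01 r01; rewrite dist_cell ?eucl_dist_upd//; exact: upd_cube.
have c0 : 0 <= (0 : R) <= 1 by rewrite lexx ler01.
have c1 : 0 <= (1 : R) <= 1 by rewrite lexx ler01.
have D01 : D (chart (upd u i 0)) (chart (upd u i 1)) = 1.
  by rewrite E// sub0r normrN normr1.
have D0t : D (chart (upd u i 0)) (chart (upd u i t)) = t.
  by rewrite E// sub0r normrN ger0_norm.
have Dt1 : D (chart (upd u i t)) (chart (upd u i 1)) = 1 - t.
  by rewrite E// distrC ger0_norm ?subr_ge0.
have := cm_CN hD x (_ : D (chart (upd u i 0)) (chart (upd u i t)) +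
  D (chart (upd u i t)) (chart (upd u i 1)) = _).
by rewrite D01 D0t Dt1 !mul1r; apply; ring.
Qed.

(** A short initial piece of the geodesic from [y] to [x] ends in the star of [y], hence in a cell
    containing [y]. *)
Lemma toward_base y (r : R) : y <> x -> 0 < r ->
  exists c (v w : 'rV[R]_(cell_dim c)),
  [/\ unit_cube R _ v, unit_cube R _ w, chart v = y, 0 < eucl_dist v w < r &
      f c w = D x y - eucl_dist v w].
Proof.
move=> yx r0; have [d d0 sd] := exists_small y.
have xy0 : 0 < D x y.
  rewrite lt_neqAle dist_ge0// andbT; apply/eqP => /esym/(cm_eq0 hD) xy.
  exact: yx.
pose e := Num.min (Num.min (d / 2) (r / 2)) (D x y).
have e0 : 0 < e by rewrite !lt_min xy0 !divr_gt0.
have ed : e <= d / 2 by rewrite !ge_min lexx.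
have er : e <= r / 2 by rewrite !ge_min lexx orbT.
have ex : e <= D x y by rewrite !ge_min lexx !orbT.
have [z [yz zx]] : exists z, D y z = e /\ D z x = D y x - e.
  by apply: (cm_between hD); rewrite (cm_sym hD y) (ltW e0).
have [|c [v [w [cv cw vy wz E]]]] := @near_star R K D hD d y z sd.
  by rewrite yz; lra.
exists c, v, w; split=> //; rewrite E yz; first by rewrite e0; lra.
by rewrite wz (cm_sym hD x z) zx (cm_sym hD y).
Qed.

Let F c (u : 'rV[R]_(cell_dim c)) := f c (clampv u).

Let F_continuous c : continuous (@F c).
Proof.
apply: eucl_lipschitz_continuous => u v; apply: le_trans (clampv_lip u v).
by apply: dist_lip; exact: clampv_cube.
Qed.

(* Both values t0 and 1 - t0 are needed, since the charts of two cells may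
   parametrize a common line in opposite directions. *)
Let balanced t0 c i (u : 'rV[R]_(cell_dim c)) :=
  [/\ unit_cube R _ u, u ord0 i = t0 \/ u ord0 i = 1 - t0 &
      forall s, 0 <= s <= 1 -> f c u <= f c (upd u i s)].

Let balanced_compact t0 c i : compact (@balanced t0 c i).
Proof.
apply: (@subclosed_compact _ _ (unit_cube R _)); [|exact: unit_cube_compact|by move=> u []].
have -> : @balanced t0 c i = unit_cube R (cell_dim c) `&`
   ((fun u : 'rV[R]_(cell_dim c) => u ord0 i) @^-1`
     ([set t | t = t0] `|` [set t | t = 1 - t0])) `&`
   \bigcap_(s in `[0, 1]) ((fun u => F (upd u i s) - F u) @^-1` [set t | 0 <= t]).
  apply/seteqP; split=> [u [cu ui um]|u [[cu ui] um]].
    split; [split=> //|move=> s s01 /=].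
    rewrite /= in_itv/= in s01.
    by rewrite subr_ge0 /F !clampv_id//; [exact: um|exact: upd_cube].
  split=> // s s01; have := um s; rewrite /= in_itv/= => /(_ s01).
  by rewrite subr_ge0 /F !clampv_id//; exact: upd_cube.
have coordc : continuous (fun u : 'rV[R]_(cell_dim c) => u ord0 i).
  exact: coord_continuous.
apply: closedI; [apply: closedI|].
- apply: compact_closed; last exact: unit_cube_compact.
  exact: norm_hausdorff.
- apply: closed_comp => [u _|]; first exact: coordc.
  by apply: closedU; exact: closed_eq.
- apply: closed_bigI => s _; apply: closed_comp => [u _|]; last exact: closed_ge.
  apply: (@continuousB R R^o _ (fun u => F (upd u i s)) (@F c) u); last exact: F_continuous.
  apply: eucl_lipschitz_continuous => {}u v.
  apply: (@le_trans _ _ (eucl_dist (upd u i s) (upd v i s))); last first.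
    exact: eucl_dist_upd_le.
  by apply: le_trans (clampv_lip _ _); apply: dist_lip; exact: clampv_cube.
Qed.

(** There are finitely many pairs of a cell and a direction, and for each of them the balanced
    points form a compact set. *)
Let balanced_min t0 c0 i0 (u0 : 'rV[R]_(cell_dim c0)) : balanced t0 i0 u0 ->
  exists c i (u : 'rV[R]_(cell_dim c)), balanced t0 i u /\
    forall c' i' (u' : 'rV[R]_(cell_dim c')), balanced t0 i' u' -> f c u <= f c' u'.
Proof.
move=> bu0; pose I := {c : cell K & 'I_(cell_dim c)}.
pose P (k : I) := exists u, balanced t0 (tagged k) u.
have /choice[m mP] : forall k : I, exists m : R, P k ->
    (exists2 u, balanced t0 (tagged k) u & f (tag k) u = m) /\
    forall u, balanced t0 (tagged k) u -> m <= f (tag k) u.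
  move=> [c i]; have [[u bu]|] := pselect (P (Tagged _ i)); last by exists 0.
  have [|||v] := @EVT_min_rV R _ (@F c) (balanced t0 i).
  - by exists u.
  - exact: balanced_compact.
  - by apply: continuous_subspaceT; exact: F_continuous.
  rewrite inE => bv vmin; exists (f c v) => _; split; first by exists v.
  move=> w bw; have := vmin w; rewrite inE => /(_ bw).
  by rewrite /F !clampv_id//; [case: bw|case: bv].
have Pk0 : `[< P (Tagged (fun c => 'I_(cell_dim c)) i0) >] by apply/asboolP; exists u0.
have := @arg_minP _ _ _ _ (fun k => `[< P k >]) m Pk0.
case=> -[c i] /asboolP Pk kmin.
have [[u bu um] _] := mP _ Pk; exists c, i, u; split=> // c' i' u' bu'.
have Pk' : P (Tagged (fun c => 'I_(cell_dim c)) i') by exists u'.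
have := kmin _ (asboolT Pk'); rewrite -um => /le_trans; apply.
by have [_] := mP _ Pk'; apply.
Qed.

(* A geodesic issuing to x from a point where the distance to x is minimal in
   some coordinate direction, but with a fractional coordinate in this direction,
   stays perpendicular to the direction and keeps this coordinate, so that it
   cannot end at a vertex. *)
Lemma no_interior_min c (u : 'rV[R]_(cell_dim c)) i : unit_cube R _ u ->
  0 < u ord0 i < 1 -> exists2 s, 0 <= s <= 1 & f c (upd u i s) < f c u.
Proof.
move=> cu ui; apply: contrapT => H.
have bu : balanced (u ord0 i) i u.
  split=> //; first by left.
  by move=> s s01; rewrite leNgt; apply/negP => lt; apply: H; exists s.
(* [u1] is closest to [x] among all balanced points; a step from it towards [x] will give a closer
   one, [w]. *)
have {bu H cu} [c1 [i1 [u1 [[cu1 u1i u1min] glob]]]] := balanced_min bu.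
set t0 := u ord0 i in ui u1i glob.
have u1i01 : 0 < u1 ord0 i1 < 1 by case: u1i => ->; apply/andP; split; lra.
have [E|yx] := pselect (chart u1 = x).
  by case: (vertex_binary x_vertex cu1 E i1) u1i01 => ->; rewrite ltxx ?andbF.
have [c2 [v [w [cv cw vy /andP[vw0 _] fw]]]] := toward_base yx ltr01.
have [j [b [vj line]]] := glue_line cu1 cv (esym vy) u1i01.
have vmin s : 0 <= s <= 1 -> f c2 v <= f c2 (upd v j s).
  by move=> s01; rewrite vy -[s](flipK b) -line ?flip01//; exact/u1min/flip01.
have wj : w ord0 j = v ord0 j.
  (* If the step changed coordinate [j], then [upd v j (w ord0 j)] would be nearer to [w] than [v]
     is, hence nearer to [x] than [v], against [vmin]. *)
  apply/eqP/negPn/negP => wvj.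
  have cv' : unit_cube R _ (upd v j (w ord0 j)) by exact/upd_cube/cw.
  have := vmin _ (cw j); have := dist_lip cv' cw.
  have lt : eucl_dist (upd v j (w ord0 j)) w < eucl_dist v w.
    rewrite -(@ltr_pXn2r _ 2)// ?nnegrE ?eucl_dist_ge0//.
    rewrite (eucl_distC v) (eucl_dist_upd_sqr w v j) eucl_distC ltrDr.
    by rewrite lt_neqAle sqr_ge0 andbT eq_sym sqrf_eq0 subr_eq0.
  by rewrite fw vy ler_norml; lra.
suff /glob : balanced t0 j w by rewrite fw; lra.
split=> //.
  rewrite wj vj; case: u1i => ->; case: (b); rewrite /flip;
    [right|left|left|right] => //; ring.
(* The line through [w] is that through [v] shifted by at most [eucl_dist v w], and [w] is closer to
   [x] than [v] by exactly this amount. *)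
move=> s s01; have := dist_lip (upd_cube j cv s01) (upd_cube j cw s01).
have := eucl_dist_upd_le v w j s; have := vmin s s01.
by rewrite fw vy ler_norml; lra.
Qed.

Lemma line_min c (u : 'rV[R]_(cell_dim c)) i : unit_cube R _ u ->
  exists b : bool, forall t, 0 <= t <= 1 -> f c (upd u i (b : nat)%:R) <= f c (upd u i t).
Proof.
move=> cu; pose g t := f c (upd u i (clamp t)).
have [||t] := @EVT_min R g 0 1; first exact: ler01.
  apply: continuous_subspaceT; apply: (@lipschitz_continuous R 1) => s t.
  apply: (@le_trans _ _ (eucl_dist (upd u i (clamp s)) (upd u i (clamp t)))); last first.
    by rewrite eucl_dist_upd mul1r clamp_lip.
  by apply: dist_lip; exact/upd_cube/clamp01.
rewrite in_itv/= => t01 tmin.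
have {}tmin s : 0 <= s <= 1 -> f c (upd u i t) <= f c (upd u i s).
  by move=> s01; have := tmin s; rewrite in_itv/= /g !clamp_id//; apply.
have [t0|tn0] := eqVneq t 0; first by exists false => s s01; rewrite /= mulr0n -t0 tmin.
have [t1|tn1] := eqVneq t 1; first by exists true => s s01; rewrite /= mulr1n -t1 tmin.
have ti : 0 < (upd u i t) ord0 i < 1.
  by rewrite updE !lt_neqAle tn1 eq_sym tn0.
have [s s01] := no_interior_min (upd_cube i cu t01) ti.
by rewrite upd_upd ltNge tmin.
Qed.

(** With equal ends, strict convexity would put the midpoint below both, while the minimum is
    attained at an end. *)
Lemma line_ends_neq c (u : 'rV[R]_(cell_dim c)) i : unit_cube R _ u ->
  f c (upd u i 0) != f c (upd u i 1).
Proof.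
move=> cu; apply/eqP => E; have [b bmin] := line_min i cu.
have h01 : 0 <= (2^-1 : R) <= 1 by apply/andP; split; lra.
have := dist_line_convex i cu h01; rewrite -E.
have := bmin _ h01.
have -> : f c (upd u i (b : nat)%:R) = f c (upd u i 0) by case: (b); rewrite ?mulr1n.
have := dist_ge0 hD x (chart (upd u i 0)).
move: (f c (upd u i 0)) (f c (upd u i 2^-1)) => p q; nra.
Qed.

Definition increasing c i (u : 'rV[R]_(cell_dim c)) := f c (upd u i 0) < f c (upd u i 1).

(** The difference of the two end values is continuous along the segment from [u] to [v], and it
    never vanishes by [line_ends_neq]. *)
Lemma increasing_cst c i (u v : 'rV[R]_(cell_dim c)) :
  unit_cube R _ u -> unit_cube R _ v -> increasing i u -> increasing i v.
Proof.
move=> cu cv; rewrite /increasing => fu; rewrite ltNge; apply/negP => fv.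
pose w s := u + clamp s *: (v - u).
have cw s : unit_cube R _ (w s) by apply: cube_convex => //; exact: clamp01.
have c0 : 0 <= (0 : R) <= 1 by rewrite lexx ler01.
have c1 : 0 <= (1 : R) <= 1 by rewrite lexx ler01.
pose g s := f c (upd (w s) i 1) - f c (upd (w s) i 0).
have w0 : w 0 = u by rewrite /w clamp_id// scale0r addr0.
have w1 : w 1 = v by rewrite /w clamp_id// scale1r addrC subrK.
have [|||s _ gs] := @IVT R g 0 1 0; first exact: ler01.
- apply: continuous_subspaceT; apply: (@lipschitz_continuous R (2 * eucl_dist u v)) => s t.
  have L e : 0 <= e <= 1 ->
      `|f c (upd (w s) i e) - f c (upd (w t) i e)| <= `|s - t| * eucl_dist u v.
    move=> e01; apply: le_trans (dist_lip (upd_cube i (cw s) e01) (upd_cube i (cw t) e01)) _.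
    apply: le_trans (eucl_dist_upd_le _ _ _ _) _; rewrite eucl_dist_along.
    by rewrite ler_wpM2r ?eucl_dist_ge0// clamp_lip.
  have := L _ c1; have := L _ c0; rewrite /g !ler_norml => /andP[? ?] /andP[? ?].
  by apply/andP; split; lra.
- by rewrite /g w0 w1 ge_min le_max !subr_le0 !subr_ge0 fv (ltW fu) orbT.
by have /eqP := line_ends_neq i (cw s); apply; move: gs; rewrite /g; lra.
Qed.

Lemma line_top c (u : 'rV[R]_(cell_dim c)) i (b : bool) : unit_cube R _ u ->
  f c (upd u i (~~ b : nat)%:R) < f c (upd u i (b : nat)%:R) ->
  u ord0 i != (b : nat)%:R -> f c u < f c (upd u i (b : nat)%:R).
Proof.
move=> cu lt uib; rewrite -{1}(upd_id u i).
have := dist_line_convex i cu (cu i); have /andP[u0 u1] := cu i.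
set t := u ord0 i in uib u0 u1 *.
have := dist_ge0 hD x (chart (upd u i t)).
have := dist_ge0 hD x (chart (upd u i 0)); have := dist_ge0 hD x (chart (upd u i 1)).
case: b lt uib; rewrite /= -?[1%:R]/(1 : R) -?[0%:R]/(0 : R);
  move: (f c (upd u i 0)) (f c (upd u i 1)) (f c (upd u i t)) => p q r pq tb p0 q0 r0 cvx.
  have t1 : t < 1 by rewrite lt_neqAle tb.
  have sq : p ^+ 2 < q ^+ 2 by nra.
  rewrite -(@ltr_pXn2r _ 2)// ?nnegrE//; nra.
have t1 : 0 < t by rewrite lt_neqAle eq_sym tb.
have sq : q ^+ 2 < p ^+ 2 by nra.
rewrite -(@ltr_pXn2r _ 2)// ?nnegrE//; nra.
Qed.

End BasePoint.

(** * Top vertices *)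

Section TopVertex.
Variables (R : realType) (K : fin_cube_complex R).
Variable D : complex_point K -> complex_point K -> R.
Hypothesis hD : cat0_dist D.
Variable x : complex_point K.
Hypothesis x_vertex : is_vertex x.
Implicit Types (c s : cell K) (p y z : complex_point K).

Local Notation f c u := (D x (@chart R K c u)).

Definition is_top c y :=
  carrier c y /\ forall z, carrier c z -> z <> y -> D x z < D x y.

Lemma is_top_uniq c y z : is_top c y -> is_top c z -> y = z.
Proof.
move=> [cy ytop] [cz ztop]; apply: contrapT => yz.
have := ytop _ cz (fun e => yz (esym e)); have := ztop _ cy yz; lra.
Qed.

Lemma is_top_sub c s y z : carrier s `<=` carrier c -> is_top s y -> is_top c z ->
  carrier s z -> y = z.
Proof.
move=> sc ys zc sz; apply: (is_top_uniq ys); split=> // t st.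
exact/zc.2/sc.
Qed.

(** The top has coordinate 1 in the increasing directions and 0 in the others: replacing the
    coordinates of [u] by those of [v] one at a time raises the distance at each change. *)
Lemma is_top_exists c : exists2 y, is_top c y & is_vertex y.
Proof.
pose o := face_corner R (@whole R K c).
have co : unit_cube R _ o by exact: (face_cornerP R _).1.
pose b i := `[< increasing D x i o >].
pose v : 'rV[R]_(cell_dim c) := \row_i (b i : nat)%:R.
have cv : unit_cube R _ v by move=> i; rewrite mxE bool01.
have bv : binary v by move=> i; rewrite mxE; case: (b i); [right|left].
exists (chart v); last exact: binary_vertex.
split; first exact: carrier_chart.
suff H n (u : 'rV[R]_(cell_dim c)) : unit_cube R _ u ->
    (#|[pred i | u ord0 i != v ord0 i]| <= n)%N -> u = v \/ f c u < f c v.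
  by move=> z [u cu <-] uv; case: (H _ u cu (leqnn _)) => // uvE; rewrite uvE in uv.
elim: n u => [|n IH] u cu.
  rewrite leqn0 => /eqP/card0_eq H; left; apply/rowP => i.
  by have := H i; rewrite !inE => /negbFE/eqP.
move=> un; have [[i ui]|/forallNP uv] := pselect (exists i, u ord0 i != v ord0 i); last first.
  by left; apply/rowP => i; apply/eqP/negPn/negP/uv.
right; have vi : v ord0 i = (b i : nat)%:R by rewrite mxE.
have v01 : 0 <= v ord0 i <= 1 by exact: cv.
have lt : f c u < f c (upd u i (v ord0 i)).
  rewrite vi; apply: line_top => //; last by rewrite -vi.
  have inc w : unit_cube R _ w -> increasing D x i w <-> b i.
    by move=> cw; split=> [/(increasing_cst hD x_vertex cw co)/asboolP//|/asboolP];
      exact: increasing_cst.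
  case bi : (b i); rewrite /= ?mulr1n ?mulr0n; first exact/inc.
  rewrite lt_neqAle eq_sym (line_ends_neq hD x_vertex)//= leNgt.
  by apply/negP => /(inc _ cu); rewrite bi.
have [||<-//|lt'] := IH (upd u i (v ord0 i)).
- exact: upd_cube.
- rewrite -ltnS; apply: leq_trans un; apply/proper_card/properP; split.
    by apply/fintype.subsetP => k; rewrite !inE mxE; case: (k =P i) => [->|_//]; rewrite eqxx.
  by exists i; rewrite !inE ?updE ?eqxx.
exact: lt_trans lt'.
Qed.

Lemma top_dist_le c y z : is_top c y -> carrier c z -> D x z <= D x y.
Proof.
by move=> [_ ytop] cz; have [->//|zy] := pselect (z = y); exact/ltW/ytop.
Qed.

Lemma top_star_cell v : v <> x -> is_vertex v ->
  exists s, [/\ is_top s v, (0 < cell_dim s)%N &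
    forall c, is_top c v -> carrier c `<=` carrier s].
Proof.
move=> vx v_vertex.
have [c0 [v0 [w0 [cv0 cw0 v0v /andP[e0 _]]]]] := toward_base hD vx (@ltr01 R).
set e := eucl_dist v0 w0 in e0 *; set q := chart w0 => fq.
have Dvq : D v q = e by rewrite -v0v (dist_cell hD).
have P0 : `[< carrier c0 v /\ carrier c0 q >].
  by apply/asboolP; split; [rewrite -v0v|]; exact: carrier_chart.
(* [s] has least dimension among the cells containing [v] and the point [q] of the geodesic to [x].
   If [a] and [b] agreed in a coordinate, a facet of [s] would do. *)
have := @arg_minnP _ c0 (fun c => `[< carrier c v /\ carrier c q >]) (@cell_dim R K) P0.
case=> s /asboolP[[a ca av] [b cb bq]] smin.
have ab : eucl_dist a b = e by rewrite -(dist_cell hD)// av bq.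
have ba : binary a by exact: vertex_binary av.
have a_neq_b i : a ord0 i != b ord0 i.
  apply/eqP => abi; pose r k := if k == i then Some (a ord0 i == 1) else None.
  have ri : ((a ord0 i == 1) : nat)%:R = a ord0 i.
    by case: (ba i) => ->; rewrite ?eqxx// eq_sym oner_eq0.
  have fa : cube_face R r a.
    by split=> // k B; rewrite /r; case: eqP => // -> [<-].
  have fb : cube_face R r b.
    by split=> // k B; rewrite /r; case: eqP => // -> [<-]; rewrite -abi.
  have [c cE] := face_cell r; rewrite -/(carrier c) in cE.
  have := smin c; rewrite (cell_dim_face cE) leqNgt => H.
  have /H/negP : `[< carrier c v /\ carrier c q >].
    by apply/asboolP; rewrite cE; split; [exists a|exists b].
  apply; rewrite /face_free -[X in (_ < X)%N]card_ord.
  apply/proper_card/properP; split; first exact/fintype.subsetP.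
  by exists i; rewrite // !inE /r eqxx.
have s_dim : (0 < cell_dim s)%N.
  rewrite lt0n; apply/negP => /eqP s0'; move: e0; rewrite -ab.
  rewrite (_ : a = b) ?eucl_distxx ?ltxx//; apply/rowP => -[k klt].
  by exfalso; move: (klt); rewrite s0'.
exists s; split=> //.
  have [y ys y_vertex] := is_top_exists s; have [[t ct ty] ytop] := ys.
  suff -> : v = y by []; rewrite -av -ty; congr chart; apply/rowP => i.
  have bt : binary t by exact: vertex_binary ty.
  apply/eqP/negPn/negP => ati.
  (* [upd b i (a ord0 i)] is at distance less than [e] from [a], whereas [q] is closer to [x] than
     [v] by [e]. So direction [i] is increasing towards [a] at [b], but towards [t] at [t], against
     [increasing_cst]. *)
  have lt1 : f s b < f s (upd b i (a ord0 i)).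
    have cb' : unit_cube R _ (upd b i (a ord0 i)) by exact/upd_cube/ca.
    have := dist_lip hD x ca cb'; rewrite av bq fq.
    have : eucl_dist a (upd b i (a ord0 i)) < e.
      rewrite -(@ltr_pXn2r _ 2)// ?nnegrE ?eucl_dist_ge0 ?(ltW e0)// -ab.
      rewrite (eucl_dist_upd_sqr a b i) ltrDr lt_neqAle sqr_ge0 andbT eq_sym.
      by rewrite sqrf_eq0 subr_eq0.
    by rewrite ler_norml; lra.
  have lt2 : f s (upd b i (t ord0 i)) < f s (upd b i (a ord0 i)).
    have [B Bmin] := line_min hD x_vertex i cb.
    have := Bmin _ (cb i); rewrite upd_id => lt3.
    have : f s (upd b i (B : nat)%:R) < f s (upd b i (a ord0 i)) by lra.
    case: (ba i) (bt i) ati => -> [] ->; rewrite ?eqxx//; case: (B) => //=;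
      by rewrite ?mulr1n ?mulr0n ltxx.
  have lt3 : f s (upd t i (a ord0 i)) < f s (upd t i (t ord0 i)).
    rewrite upd_id ty; apply: ytop; first exact/carrier_chart/upd_cube/ca.
    rewrite -ty => /(chart_inj _ ct) H; move: ati.
    by rewrite -[in X in _ != X]H ?updE ?eqxx//; exact/upd_cube/ca.
  case: (ba i) (bt i) ati lt2 lt3 => -> [] ->; rewrite ?eqxx// => _ lt2 lt3.
    by have := increasing_cst hD x_vertex ct cb lt3; rewrite /increasing; lra.
  by have := increasing_cst hD x_vertex cb ct lt2; rewrite /increasing; lra.
move=> c [cv vtop].
have sv : carrier s v by exists a.
have [z cz zv] := cv.
have [a' a'P] := common_face cv sv.
have fz : cube_face R a' z by apply/a'P => //; rewrite zv.
apply: contrapT => ncs.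
(* As [c] is not contained in [s], their common face freezes some coordinate; [E] follows the edge
   of [c] issuing from [v] in this direction. *)
have [i [B a'i]] : exists i B, a' i = Some B.
  apply: contrapT => H; apply: ncs => y [u cu <-]; apply/a'P => //; split=> // i B a'i.
  by exfalso; apply: H; exists i, B.
have zi : z ord0 i = flip B 0.
  by rewrite (fz.2 _ _ a'i) /flip; case: (B); rewrite ?subr0.
pose E t := upd z i (flip B t).
have E0 : E 0 = z by rewrite /E -zi upd_id.
have cE t : 0 <= t <= 1 -> unit_cube R _ (E t) by move=> t01; exact/upd_cube/flip01.
have c01 : 0 <= (0 : R) <= 1 by rewrite lexx ler01.
have c11 : 0 <= (1 : R) <= 1 by rewrite lexx ler01.
have DE t t' : 0 <= t <= 1 -> 0 <= t' <= 1 -> D (chart (E t)) (chart (E t')) = `|t - t'|.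
  move=> t01 t'01; rewrite (dist_cell hD) ?eucl_dist_upd; [|exact: cE..].
  by rewrite /flip; case: (B) => //; rewrite distrC; congr `|_|; ring.
have [d d0 sd] := exists_small v.
pose r := Num.min 1 (d / (2 * e)).
have r0 : 0 < r by rewrite lt_min ltr01 divr_gt0// mulr_gt0.
have r1 : r <= 1 by rewrite ge_min lexx.
have rd : r * e <= d / 2.
  have : r <= d / (2 * e) by rewrite ge_min lexx orbT.
  by rewrite ler_pdivlMr ?mulr_gt0// => ?; lra.
clearbody r; pose m := a + r *: (b - a).
have cm : unit_cube R _ m by apply: cube_convex => //; rewrite ltW.
have dma : eucl_dist m a = r * e.
  have := eucl_dist_along a b r 0; rewrite scale0r addr0 -/m ab subr0.
  by rewrite gtr0_norm.
have dmb : eucl_dist m b = (1 - r) * e.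
  have := eucl_dist_along a b r 1; rewrite scale1r addrCA subrr addr0 -/m ab.
  by rewrite distrC ger0_norm// subr_ge0.
have Dvm : D v (chart m) = r * e by rewrite -av (dist_cell hD)// eucl_distC.
have Dxm : D x (chart m) = D x v - r * e.
  have := dist_lip hD x cm cb; rewrite dmb bq fq ler_norml => /andP[_ H1].
  have := cm_tri hD (chart m) x v; rewrite (cm_sym hD (chart m) v) Dvm => H2.
  by lra.
have s_gt0 : 0 < r * e by rewrite mulr_gt0.
(* The retraction onto [s] fixes [m], sends the whole edge [E] to [v] and does not increase small
   distances. *)
have key t : 0 <= t <= 1 -> r * e <= D (chart m) (chart (E t)).
  move=> t01; rewrite -dma leNgt; apply/negP => lt.
  have : eucl_dist m a <= D (chart m) (chart (E t)).
    apply: (@star_retract_dist _ _ _ hD d v s s a m) => //; first by lra.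
      exact: star_retract_id.
    exists c, a', (E t); split=> //; first by split=> //; exact: cE.
    rewrite av -zv; congr chart; apply/rowP => k; rewrite !mxE.
    case a'k : (a' k) => [B'|]; first by rewrite (fz.2 _ _ a'k).
    by case: (k =P i) a'k => [->|//]; rewrite a'i.
  lra.
have l0 : 0 < D x v.
  by rewrite lt_neqAle dist_ge0// andbT; apply/eqP => /esym/(cm_eq0 hD)/esym.
have sl : r * e <= D x v by have := dist_ge0 hD x (chart m); lra.
set l := D x v in l0 sl Dxm vtop *; set sg := r * e in Dvm Dxm key s_gt0 sl *.
(* [CN1] comes from the CN inequality seen from [m] along the edge [E], [CN2] is the one seen from
   [E 1] along the geodesic from [v] to [x]. With [g_lt] they force [sg < l * t], while this choice
   makes [l * t] half of [sg]. *)
pose t := sg / (2 * l).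
have lt2 : 2 * l * t = sg by rewrite /t; field; exact: lt0r_neq0.
have t0 : 0 < t by rewrite divr_gt0// mulr_gt0.
have t1 : t <= 1 by rewrite ler_pdivrMr ?mulr_gt0// mul1r; lra.
have t01 : 0 <= t <= 1 by rewrite ltW.
set A := D (chart m) (chart (E 1)).
have DvE : D (chart (E 1)) v = 1 by rewrite -zv -E0 DE// subr0 normr1.
have CN1 : sg ^+ 2 + 1 - t <= A ^+ 2.
  have De0t : D v (chart (E t)) = t.
    by rewrite -zv -E0 DE// sub0r normrN gtr0_norm.
  have Det1 : D (chart (E t)) (chart (E 1)) = 1 - t.
    by rewrite DE// distrC ger0_norm ?subr_ge0.
  have sum : D v (chart (E t)) + D (chart (E t)) (chart (E 1)) = D v (chart (E 1)).
    by rewrite De0t Det1 (cm_sym hD v) DvE; ring.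
  have := cm_CN hD (chart m) sum.
  rewrite De0t Det1 (cm_sym hD v (chart (E 1))) DvE (cm_sym hD (chart m) v) Dvm.
  rewrite -/A !mul1r => H.
  have K1 : sg ^+ 2 <= D (chart m) (chart (E t)) ^+ 2.
    by apply: lerXn2r; rewrite ?nnegrE ?dist_ge0 ?(ltW s_gt0)//; exact: key.
  by rewrite -(ler_pM2l t0); lra.
have g_lt : D x (chart (E 1)) < l.
  apply: vtop; first exact/carrier_chart/cE.
  rewrite -zv -E0 => /(chart_inj (cE _ c11) (cE _ c01))/(congr1 (fun u : 'rV_ _ => u ord0 i)).
  by rewrite !updE /flip; case: (B); lra.
have g0 := dist_ge0 hD x (chart (E 1)).
have sum : D v (chart m) + D (chart m) x = D v x.
  by rewrite Dvm (cm_sym hD (chart m)) Dxm (cm_sym hD v x) -/l; ring.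
have := cm_CN hD (chart (E 1)) sum.
rewrite (cm_sym hD v x) (cm_sym hD (chart m) x) Dvm Dxm -/l DvE.
rewrite (cm_sym hD (chart (E 1)) (chart m)) -/A (cm_sym hD (chart (E 1)) x) => CN2.
have gl : D x (chart (E 1)) ^+ 2 < l ^+ 2 by nra.
have H1 := ler_wpM2l (ltW l0) CN1.
have {gl} H2 : sg * D x (chart (E 1)) ^+ 2 < sg * l ^+ 2 by rewrite ltr_pM2l.
move: CN2 H1 H2 lt2 s_gt0; clear; move: (D x (chart (E 1))) => g; lra.
Qed.

End TopVertex.

(** * Collapsing *)

Section Subcells.
Variables (R : realType) (K : fin_cube_complex R).
Implicit Types (c s t : cell K).

Lemma bool_natr_inj (b b' : bool) : (b : nat)%:R = (b' : nat)%:R :> R -> b = b'.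
Proof. by case: b b' => [] [] // /eqP; rewrite ?oner_eq0// eq_sym oner_eq0. Qed.

Lemma chart_face_sub c (a b : 'I_(cell_dim c) -> option bool) :
  chart @` cube_face R a `<=` chart @` cube_face R b <->
  forall i B, b i = Some B -> a i = Some B.
Proof.
split=> [ab i B bi|ab _ [u [cu fu] <-]]; last first.
  by exists u => //; split=> // i B /ab; exact: fu.
have sub u : cube_face R a u -> u ord0 i = (B : nat)%:R.
  move=> fu; have : (chart @` cube_face R b) (chart u) by apply: ab; exists u.
  by move=> /(chart_face_mem fu.1)[_]; exact.
have fa := face_cornerP R a.
case ai : (a i) => [B'|].
  by congr Some; apply: bool_natr_inj; rewrite -(sub _ fa) (fa.2 _ _ ai).
have := sub _ (cube_face_upd fa ai (bool01 R (~~ B))).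
by rewrite updE => /bool_natr_inj; case: B {bi sub}.
Qed.

Lemma chart_face_inj c (a b : 'I_(cell_dim c) -> option bool) :
  chart @` cube_face R a = chart @` cube_face R b -> a = b.
Proof.
move=> ab; apply/funext => i.
have /chart_face_sub H1 : chart @` cube_face R a `<=` chart @` cube_face R b by rewrite ab.
have /chart_face_sub H2 : chart @` cube_face R b `<=` chart @` cube_face R a by rewrite ab.
case ai : (a i) => [B|]; first by rewrite (H2 _ _ ai).
by case bi : (b i) => [B|//]; rewrite (H1 _ _ bi) in ai.
Qed.

Lemma subcell_dim c s : carrier s `<=` carrier c ->
  s = c \/ (cell_dim s < cell_dim c)%N.
Proof.
move=> /subcell_face[a sE]; rewrite (cell_dim_face sE).
have [[i ai]|/forallNP a0] := pselect (exists i, a i <> None); [right|left].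
  rewrite /face_free -[X in (_ < X)%N]card_ord; apply/proper_card/properP; split.
    exact/fintype.subsetP.
  by exists i => //; rewrite inE; apply/eqP.
apply: cell_inj; rewrite -/(carrier s) sE (_ : a = @whole R K c) ?whole_face//.
by apply/funext => i; apply: contrapT; exact: a0.
Qed.

Definition unfreeze n (i : 'I_n) (a : 'I_n -> option bool) k :=
  if k == i then None else a k.

Lemma face_free_unfreeze n (i : 'I_n) a : a i <> None ->
  face_free (unfreeze i a) = (face_free a).+1.
Proof.
move=> /eqP/negPf ai; rewrite /face_free (cardD1 i) !inE /unfreeze !eqxx add1n.
congr _.+1; apply: eq_card => k; rewrite !inE; case: (k =P i) => // ->.
by rewrite ai.
Qed.

End Subcells.

(** * Matching of the cells with a common top, and order of the collapses *)

Section Matching.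
Variables (R : realType) (K : fin_cube_complex R).
Variable D : complex_point K -> complex_point K -> R.
Hypothesis hD : cat0_dist D.
Variables (x : complex_point K) (x0 : cell K).
Hypothesis x0_dim : cell_dim x0 = 0%N.
Hypothesis x0_x : carrier x0 x.
Variable T : cell K -> complex_point K.
Hypothesis T_top : forall c, is_top D x c (T c).
Hypothesis T_vertex : forall c, is_vertex (T c).
Implicit Types (c s t : cell K).

Let x_vertex : is_vertex x. Proof. by exists x0. Qed.

Lemma base_carrier y : carrier x0 y -> y = x.
Proof.
case: x0_x => u _ <- [v _ <-]; congr chart; apply/rowP => -[i ilt].
by exfalso; move: (ilt); rewrite x0_dim.
Qed.

Lemma base_cell c : T c = x -> c = x0.
Proof.
move=> Tcx; have [cx cmax] := T_top c; rewrite Tcx in cx cmax.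
apply: cell_inj; apply/seteqP; split=> [y cy|y /base_carrier ->//].
suff -> : y = x by [].
apply: contrapT => /(cmax _ cy); rewrite (cm_refl hD).
by have := dist_ge0 hD x y; lra.
Qed.

Lemma T_sub s c : carrier s `<=` carrier c -> carrier s (T c) -> T s = T c.
Proof. by move=> sc; exact: is_top_sub sc (T_top s) (T_top c). Qed.

Definition star_cell s v :=
  [/\ is_top D x s v, v <> x & forall c, is_top D x c v -> carrier c `<=` carrier s].

Lemma star_cell_uniq s s' v : star_cell s v -> star_cell s' v -> s = s'.
Proof.
move=> [sv _ smax] [s'v _ s'max]; apply: cell_inj.
by apply/seteqP; split; [exact: s'max|exact: smax].
Qed.

(* The cells with top vertex v are the faces through v of one cube, the star
   cell; they are matched along its coordinate 0. *)
Definition mates s t := exists c (i : 'I_(cell_dim c)) a,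
  [/\ star_cell c (T s), i = 0%N :> nat, a i <> None,
      carrier s = chart @` cube_face R a &
      carrier t = chart @` cube_face R (unfreeze i a)].

Lemma mates_sub s t : mates s t -> carrier s `<=` carrier t.
Proof.
move=> [c [i [a [_ _ _ -> ->]]]]; apply/chart_face_sub => k B.
by rewrite /unfreeze; case: eqP.
Qed.

Lemma face_carrier_sub c s (a : 'I_(cell_dim c) -> option bool) :
  carrier s = chart @` cube_face R a -> carrier s `<=` carrier c.
Proof. by move=> -> _ [u [cu _] <-]; exact: carrier_chart. Qed.

Lemma mates_T s t : mates s t -> T t = T s.
Proof.
move=> st; have := mates_sub st; have [c [i [a [[cT _ _] _ _ _ tE]]]] := st.
move=> sub; rewrite -(is_top_uniq (T_top c) cT); apply: T_sub.
  exact: face_carrier_sub tE.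
by rewrite (is_top_uniq (T_top c) cT); exact/sub/(T_top s).1.
Qed.

Lemma mates_dim s t : mates s t -> cell_dim t = (cell_dim s).+1.
Proof.
move=> [c [i [a [_ _ ai sE tE]]]].
by rewrite (cell_dim_face sE) (cell_dim_face tE) face_free_unfreeze.
Qed.

(** [c] is a face of the star cell of its top; it is the lower or the upper mate according to
    whether coordinate 0 is frozen or free. *)
Lemma mates_exist c : T c <> x -> exists s t, mates s t /\ (c = s \/ c = t).
Proof.
move=> Tcx; have [s [sT s_dim smax]] := top_star_cell hD x_vertex Tcx (T_vertex c).
have sE : star_cell s (T c) by [].
have [a cE] := subcell_face (smax _ (T_top c)).
pose i := Ordinal s_dim.
have [z fz zT] : (chart @` cube_face R a) (T c) by rewrite -cE; exact: (T_top c).1.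
have bz := vertex_binary (T_vertex c) fz.1 zT.
have Ts : T s = T c by exact: is_top_uniq (T_top s) sT.
have [ai|ai] := pselect (a i = None); last first.
  have [t tE] := face_cell (unfreeze i a).
  by exists c, t; split; [exists s, i, a; split|left].
(* Coordinate 0 is frozen at its value at the top, so that the lower mate still contains the top. *)
pose b k := if k == i then Some (z ord0 i == 1) else a k.
have [s' s'E] := face_cell b; rewrite -/(carrier s') in s'E.
have aE : unfreeze i b = a.
  by apply/funext => k; rewrite /unfreeze /b; case: eqP => // ->.
have sub : carrier s' `<=` carrier c.
  by rewrite s'E cE; apply/chart_face_sub => k B; rewrite /b; case: eqP => // ->; rewrite ai.
have s'T : carrier s' (T c).
  rewrite s'E; exists z => //; split=> [|k B]; first exact: fz.1.
  rewrite /b; case: eqP => [-> [<-]|_]; last exact: fz.2.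
  by case: (bz i) => ->; rewrite ?eqxx// eq_sym oner_eq0.
exists s', c; split; last by right.
exists s, i, b; split=> //; first by rewrite (T_sub sub s'T).
by rewrite aE.
Qed.

Lemma mates_frozen c s i (a : 'I_(cell_dim c) -> option bool) z B :
  carrier s = chart @` cube_face R a -> unit_cube R _ z -> chart z = T s ->
  a i = Some B -> z ord0 i = (B : nat)%:R.
Proof.
move=> sE cz zT; apply: (chart_face_mem cz _).2.
by rewrite -sE zT; exact: (T_top s).1.
Qed.

(** Mates share their top, hence their star cell, and frozen coordinates take their values at the
    top. So [unfreeze i a] determines [a], and a lower mate, having coordinate 0 frozen, is never an
    upper one. *)
Lemma mates_uniq s t s' t' : mates s t -> mates s' t' ->
  [\/ s = s', t = t', s = t' | t = s'] -> s = s' /\ t = t'.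
Proof.
move=> st st' H.
have TT : T s = T s'.
  by case: H st st' => [->//|->|->|->] /mates_T E /mates_T E'; congruence.
move: st st' => [c [i [a [cT i0 ai sE tE]]]] [c' [i' [a' [c'T i'0 a'i sE' tE']]]].
rewrite -TT in c'T; have cc := star_cell_uniq c'T cT; subst c'.
have ii : i' = i by apply: ord_inj; rewrite i0.
subst i'; have [[[z cz zT] _] _ _] := cT.
suff aa : a = a'.
  by split; apply: cell_inj; [rewrite -/(carrier s) sE aa|rewrite -/(carrier t) tE aa].
case: H => E.
- by apply: chart_face_inj; rewrite -sE -sE' E.
- have : unfreeze i a = unfreeze i a'.
    by apply: chart_face_inj; rewrite -tE -tE' E.
  move=> /funeqP aa; apply/funext => k; have := aa k; rewrite /unfreeze.
  case: eqP => // -> _; case bi : (a i) ai => [B|]// _; case b'i : (a' i) a'i => [B'|]// _.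
  congr Some; apply: (@bool_natr_inj R).
  by rewrite -(mates_frozen sE cz zT bi) -(mates_frozen sE' cz (etrans zT TT) b'i).
- have : a = unfreeze i a' by apply: chart_face_inj; rewrite -sE -tE' E.
  by move=> /funeqP/(_ i); rewrite /unfreeze eqxx.
- have : unfreeze i a = a' by apply: chart_face_inj; rewrite -tE -sE' E.
  by move=> /funeqP/(_ i); rewrite /unfreeze eqxx => /esym.
Qed.

(** [s'] and [t'] differ only in coordinate 0, which [s] and [s'] freeze at the same value, that of
    the common top. *)
Lemma mates_lower_sub s t s' t' : mates s t -> mates s' t' -> T s = T s' ->
  carrier s `<=` carrier t' -> carrier s `<=` carrier s'.
Proof.
move=> [c [i [a [cT i0 ai sE tE]]]] [c' [i' [a' [c'T i'0 a'i sE' tE']]]] TT.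
rewrite -TT in c'T; have cc := star_cell_uniq c'T cT; subst c'.
have ii : i' = i by apply: ord_inj; rewrite i0.
subst i'; have [[[z cz zT] _] _ _] := cT.
rewrite sE sE' tE' => /chart_face_sub aa'; apply/chart_face_sub => k B a'k.
have [ki|/eqP/negPf ki] := pselect (k = i); last by apply: aa'; rewrite /unfreeze ki.
subst k; case bi : (a i) ai => [B'|]// _; congr Some; apply: (@bool_natr_inj R).
by rewrite -(mates_frozen sE cz zT bi) -(mates_frozen sE' cz (etrans zT TT) a'k).
Qed.

Local Notation collapses :=
  (connect (fun A B : {set cell K} => `[< elementary_collapse A B >])).

(** Induction on the number of cells, [A] remaining the union of [x0] and of whole matched pairs.
    The pair removed has its top as far from [x] as possible and, for that distance, a lower mate of
    greatest dimension. *)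
Lemma collapse_matched (A : {set cell K}) : x0 \in A ->
  (forall s t, mates s t -> (s \in A) = (t \in A)) -> collapses A [set x0]%SET.
Proof.
have [n] := ubnP #|A|; elim: n A => // n IH A An x0A clA.
have [->|/eqP Ax0] := pselect (A = [set x0]%SET); first exact: connect0.
have [c cA cx0] : exists2 c, c \in A & c <> x0.
  apply: contrapT => H; move/eqP: Ax0; apply; apply/setP => c; rewrite inE.
  apply/idP/eqP => [cA|->//].
  by apply: contrapT => cx0; apply: H; exists c.
have lowerP c' : c' \in A -> c' <> x0 ->
    exists s t, [/\ mates s t, s \in A, T s = T c' & c' = s \/ c' = t].
  move=> c'A c'x0; have [s [t [st cst]]] := mates_exist (fun e => c'x0 (base_cell e)).
  exists s, t; split=> //; first by case: cst c'A => -> //; rewrite (clA _ _ st).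
  by case: cst => -> //; rewrite (mates_T st).
pose low s := (s \in A) && `[< exists t, mates s t >].
have [s0 [t0 [st0 s0A _ _]]] := lowerP c cA cx0.
have low0 : low s0 by rewrite /low s0A; apply/asboolP; exists t0.
have [s1 low1 max1] := @arg_maxP _ _ _ _ low (fun s => D x (T s)) low0.
have low1' : low s1 && (D x (T s1) == D x (T s1)) by rewrite low1 eqxx.
have [s /andP[/andP[sA /asboolP[t st]] /eqP Ds] maxs] :=
  @arg_maxnP _ s1 (fun s => low s && (D x (T s) == D x (T s1))) (@cell_dim R K) low1'.
have tA : t \in A by rewrite -(clA _ _ st).
have Tsx : T s <> x by case: st => ? [? [? [[]]]].
have ssub := mates_sub st.
have stN : s <> t by move=> E; have := mates_dim st; rewrite -E => /n_Sn.
apply: (@connect_trans _ _ (A :\: [set s; t]%SET)).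
  apply/connect1/asboolP; exists s, t; split=> //.
  - split=> // ts; apply: stN; apply: cell_inj.
    by apply/seteqP; split.
  - exact: mates_dim.
  (* The top of [c'] is at least as far from [x] as that of [s], hence by maximality the same. The
     lower mate in the pair of [c'] then contains [s], and equals it by the choice of the
     dimension. *)
  - move=> c' c'A [sc' c's].
    have sTc' : carrier c' (T s) by exact/sc'/(T_top s).1.
    have Dsc' := top_dist_le (T_top c') sTc'.
    have c'x0 : c' <> x0.
      move=> c'E; subst c'; case: (subcell_dim sc') => [sx0|].
        by apply: c's; rewrite sx0.
      by rewrite x0_dim.
    have [s' [t' [st' s'A Ts' c'st']]] := lowerP c' c'A c'x0.
    have low' : low s' by rewrite /low s'A; apply/asboolP; exists t'.
    have D's : D x (T c') <= D x (T s) by rewrite -Ts' Ds; exact: max1.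
    have TT : T s = T c'.
      by apply: contrapT => /((T_top c').2 _ sTc'); lra.
    have st's : carrier s `<=` carrier t'.
      by case: c'st' => E; rewrite E in sc' => //; apply: subset_trans sc' _; exact: mates_sub.
    have s's := mates_lower_sub st st' (etrans TT (esym Ts')) st's.
    have s'E : s = s'.
      have s'P : low s' && (D x (T s') == D x (T s1)) by rewrite low' Ts' -TT Ds eqxx.
      by case: (subcell_dim s's) => // lt;
        have : (cell_dim s' <= cell_dim s)%N := maxs _ s'P; rewrite leqNgt lt.
    have [_ t'E] := mates_uniq st st' (Or41 _ _ _ s'E).
    case: c'st' => [c'E|->//]; exfalso; apply: c's.
    by rewrite c'E -s'E.
apply: IH.
- rewrite -ltnS (leq_trans _ An)// ltnS; apply/proper_card/properP; split.
    exact: subsetDl.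
  by exists s => //; rewrite !inE eqxx.
- have Tx0 : T x0 = x by exact/base_carrier/(T_top x0).1.
  rewrite !inE x0A andbT; apply/norP; split; apply/eqP => E.
    by apply: Tsx; rewrite -E.
  by apply: Tsx; rewrite -(mates_T st) -E.
- move=> s' t' st'; rewrite !inE (clA _ _ st'); congr (~~ _ && _).
  have U := mates_uniq st st'.
  apply/idP/idP => /orP[]/eqP E.
  + by have [_ ->] := U (Or41 _ _ _ (esym E)); rewrite eqxx orbT.
  + by have [sE tE] := U (Or44 _ _ _ (esym E)); rewrite -tE eqxx orbT.
  + by have [-> _] := U (Or43 _ _ _ (esym E)); rewrite eqxx.
  + by have [-> _] := U (Or42 _ _ _ (esym E)); rewrite eqxx.
Qed.

End Matching.

Theorem theorem34 (R : realType) (K : fin_cube_complex R)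
  (hK : CAT0_complex K) : collapsible K.
Proof.
have [[p] [D hD]] := CAT0_complex_dist hK.
(* A corner of any cell serves as base vertex. *)
have [c _] := chart_cover p; pose o := face_corner R (@whole R K c).
have co : unit_cube R _ o := (face_cornerP R _).1.
have x_vertex := binary_vertex co (face_corner_binary R _).
have [x0 x0_dim x0_x] := x_vertex.
have /choice[T TP] : forall s, exists y, is_top D (chart o) s y /\ is_vertex y.
  by move=> s; have [y ? ?] := is_top_exists hD x_vertex s; exists y.
exists x0 => //; apply: (collapse_matched hD x0_dim x0_x (T := T)).
- by move=> s; have [] := TP s.
- by move=> s; have [] := TP s.
- by rewrite inE.
- by move=> s t _; rewrite !inE.
Qed.
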